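(* There exists $C>0$ such that for all $m\in\mathbb{N}$ and all $n\ge C m^6$ there are sets $P_1,\ldots,P_m\subseteq\{0,1\}^n$ such that: (1) $P_i\cap P_j=\emptyset$ for all $i\ne j$; (2) $|P_i|=\lfloor 2^n/m\rfloor$ for all $i$; (3) for each $i$, every $x\in P_i$ and $y\in P_{i+1}$ satisfy $|x|\le|y|$, and every $x\in P_1\cup\cdots\cup P_m$ and $y\notin P_1\cup\cdots\cup P_m$ satisfy $|x|\le|y|$; (4) for each $i<m$ there is a monotone matching from $P_i$ to $P_{i+1}$, i.e. a bijection $\sigma\colon P_i\to P_{i+1}$ with $x\le\sigma(x)$ for all $x\in P_i$. In particular, the function $\phi\colon\{0,1\}^n\to[m]$ defined by $\phi(x)=i-1$ if $x\in P_i$ and $\phi(x)=m-1$ otherwise is monotone and admits an $m2^{-n}$-almost perfect matching.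
   Context: $|x|$ is Hamming weight; $\{0,1\}^n$ has the coordinatewise order; $[m]=\{0,\ldots,m-1\}$. For $\phi\colon\{0,1\}^r\to[m]$ let $A_i=\phi^{-1}(i)$. $\phi$ admits a $\delta$-almost perfect matching if there are matchings $E_0,\ldots,E_{m-2}$, where $E_i$ is a matching between $A_i$ and $A_{i+1}$ consisting of pairs $(x,y)$ with $x\in A_i$, $y\in A_{i+1}$, $x<y$, such that for each $i$ the number of vertices of $A_i$ and of $A_{i+1}$ not covered by $E_i$ is at most $\delta\cdot 2^r$. *)

(* Defs.v *)
From mathcomp Require Import all_boot all_order all_algebra reals.
Set Implicit Arguments.
Unset Strict Implicit.
Unset Printing Implicit Defensive.

Import Order.TTheory GRing.Theory Num.Theory.

(* [_.-tupleprod bool] carries the coordinatewise order, with [false < true]. *)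
Definition cube (n : nat) := (n.-tupleprod bool)%type.

Definition hweight (n : nat) (x : cube n) : nat := #|[set k : 'I_n | tnth x k]|.

Definition monotone_bijection (n : nat) (A B : {set cube n})
    (sigma : cube n -> cube n) : Prop :=
  [/\ {in A &, injective sigma}, sigma @: A = B
    & {in A, forall x, (x <= sigma x)%O}].

(* A matching between two (disjoint) vertex classes: edges are pairs with first
   endpoint in [A] and second endpoint in [B], and distinct edges share no
   endpoint. *)
Definition increasing_matching (n : nat) (A B : {set cube n})
    (E : {set cube n * cube n}) : Prop :=
  (forall x y, (x, y) \in E -> [/\ x \in A, y \in B & (x < y)%O]) /\
  {in E &, injective fst} /\ {in E &, injective snd}.

Definition uncovered (n : nat) (A B : {set cube n})
    (E : {set cube n * cube n}) : nat :=
  #|A :\: [set e.1 | e in E]| + #|B :\: [set e.2 | e in E]|.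

Definition level (n m : nat) (phi : cube n -> 'I_m) (k : nat) : {set cube n} :=
  [set x | phi x == k :> nat].

Definition almost_perfect_matching (R : realType) (n m : nat)
    (phi : cube n -> 'I_m) (delta : R) : Prop :=
  exists E : 'I_m.-1 -> {set cube n * cube n},
    forall i : 'I_m.-1,
      increasing_matching (level phi i) (level phi i.+1) (E i) /\
      ((uncovered (level phi i) (level phi i.+1) (E i))%:R
         <= delta * 2 ^+ n)%R.

(* Main.v *)
Require Import Defs.
From mathcomp Require Import all_boot all_order all_algebra all_fingroup reals.
From mathcomp Require Import boolp sequences exp lra ring zify.
Set Implicit Arguments.
Unset Strict Implicit.
Unset Printing Implicit Defensive.
Import Order.TTheory GRing.Theory Num.Theory.

(**
Order the cube by weight and cut it at the multiples of [N = 2^n / m].  By Hall's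
theorem the slabs [P] and [Q] between consecutive cuts are matched monotonically
as soon as [#|P :&: I| <= #|Q :&: I|] for every up-set [I].  Let [z_h] be the
density of [I] in level [h].  It is nondecreasing in [h] and, since the
transpositions connect a level, even [z_(h+1) - z_h >= z_h (1 - z_h) / n^2].
A slab spans many levels, so on full levels this growth leaves room of order
[N z (1 - z) / n^2].  The only loss comes from the levels that are split by a cut.
A first-moment argument over subsets of prescribed size provides a splitting of
level [b] for which every vertex at level [b - k] or [b + k] sees both parts in
the right proportion up to [n^-4]; then the loss is at most [2^n z (1 - z) / n^4],
up to a constant factor.  Very low and very high levels may be split arbitrarily,
because they contain at most [2^n / n^4] vertices.
*)

(** The up-set [I] may be almost empty or almost full, so a fixed additive error at a split level
    would be fatal: gain and loss must both carry the factor [z (1 - z)]. The gain has it through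
    [dens_growth], the loss through [biregular_density]. The distance [k = 2 t] is forced by the
    union bound. Controlling up to [2 ^ n] vertices with relative error [n ^ -4] takes
    neighbourhoods of size about [n * n ^ 8], while a vertex has at most [n] neighbours in an
    adjacent level. At distance [2 t] from a level [l] with [l] and [n - l] above [sqrt n] there are
    at least [n ^ t / (2 t)!] comparable vertices, so [t = 10] is enough. The price is that the [k]
    levels on either side of a cut are compared with a density from the unfavourable side. A level
    holds at most [2 ^ n / sqrt n] vertices and a slab about [2 ^ n / m], so these levels are a
    small part of a slab once [sqrt n] exceeds a constant multiple of [m]. *)

(** * Hall's marriage theorem *)

Section Hall.
Variables (T U : finType) (u0 : U).

Definition nbhd (r : T -> U -> bool) (A : {set T}) : {set U} :=
  [set y | [exists x in A, r x y]].

Lemma nbhdP (r : T -> U -> bool) (A : {set T}) (y : U) :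
  reflect (exists2 x, x \in A & r x y) (y \in nbhd r A).
Proof. by rewrite inE; apply: exists_inP. Qed.

Theorem hall (r : T -> U -> bool) (P : {set T}) :
  (forall A : {set T}, A \subset P -> #|A| <= #|nbhd r A|) ->
  exists f : T -> U, {in P &, injective f} /\ {in P, forall x, r x (f x)}.
Proof.
have [k] := ubnP #|P|; elim: k r P => // k IH r P ltPk hallP.
have [-> | [x0 Px0]] := set_0Vmem P.
  by exists (fun=> u0); split=> x; rewrite inE.
(* If some nonempty proper [A] is tight, [A] and [P :\: A] are matched separately, the latter
   avoiding [nbhd r A]. Otherwise every such [A] has a spare neighbour, and [x0] may take any
   partner. In both cases the relation is shrunk to [r'], so that used endpoints disappear while [U]
   stays fixed. *)
have [|noTight] := boolP [exists A : {set T},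
    [&& A \proper P, A != set0 & #|nbhd r A| <= #|A|]].
  case/existsP=> A /and3P[ltAP A0 tight].
  have sAP := proper_sub ltAP.
  have ltA : #|A| < k by apply: leq_trans (proper_card ltAP) _.
  have [|f1 [inj1 r1]] := IH r A ltA.
    by move=> B sBA; apply: hallP; apply: subset_trans sAP.
  pose r' x y := r x y && (y \notin nbhd r A).
  have ltD : #|P :\: A| < k.
    apply: leq_trans (_ : #|P| <= k); last by [].
    apply: proper_card; rewrite properE subsetDl /=.
    apply/negP=> /subsetP sPD; case/set0Pn: A0 => a Aa.
    by have := sPD _ (subsetP sAP _ Aa); rewrite inE Aa.
  have [|f2 [inj2 r2]] := IH r' (P :\: A) ltD.
    move=> B sB.
    have sBP : B \subset P by apply: subset_trans sB (subsetDl _ _).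
    have dAB : A :&: B = set0.
      apply/setP=> y; rewrite !inE; apply/negP=> /andP[Ay By].
      by have := subsetP sB _ By; rewrite inE Ay.
    have := hallP (A :|: B); rewrite subUset sAP sBP => /(_ isT).
    rewrite cardsU dAB cards0 subn0 => le1.
    have sub : nbhd r (A :|: B) \subset nbhd r A :|: nbhd r' B.
      apply/subsetP=> y /nbhdP[x]; rewrite inE => /orP[Ax|Bx] rxy.
        by rewrite inE; apply/orP; left; apply/nbhdP; exists x.
      rewrite inE; have [//|nA] := boolP (y \in nbhd r A).
      by apply/nbhdP; exists x => //; rewrite /r' rxy.
    have := leq_trans (leq_trans le1 (subset_leq_card sub)) (leq_card_setU _ _).
    by move=> le2; rewrite -(leq_add2l #|A|) (leq_trans le2) ?leq_add2r.
  exists (fun x => if x \in A then f1 x else f2 x); split=> [x y Px Py|x Px] /=.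
    have cross u v : u \in A -> v \in P -> v \notin A -> f1 u <> f2 v.
      move=> Au Pv nAv E; have /r2/andP[_ /negP[]] : v \in P :\: A by rewrite inE nAv.
      by rewrite -E; apply/nbhdP; exists u => //; apply: r1.
    case: ifPn => Ax; case: ifPn => Ay E.
    - exact: inj1.
    - by case: (cross x y).
    - by case: (cross y x).
    - by apply: inj2 => //; rewrite inE ?Ax ?Ay.
  by case: ifPn => Ax; [exact: r1|have /r2/andP[] : x \in P :\: A by rewrite inE Ax].
have [y rxy] : exists y, r x0 y.
  have := hallP [set x0]; rewrite sub1set Px0 cards1 => /(_ isT).
  rewrite card_gt0 => /set0Pn[y /nbhdP[x]]; rewrite inE => /eqP-> rxy.
  by exists y.
pose r' x z := r x z && (z != y).
have ltD : #|P :\ x0| < k by move: ltPk; rewrite (cardsD1 x0 P) Px0.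
have [|f [injf rf]] := IH r' (P :\ x0) ltD.
  move=> B sB; have [->|B0] := eqVneq B set0; first by rewrite cards0.
  have pB : B \proper P.
    apply: sub_proper_trans sB _; rewrite properE subD1set /=.
    by apply/negP=> /subsetP/(_ x0 Px0); rewrite !inE eqxx.
  move: noTight; rewrite negb_exists => /forallP/(_ B); rewrite pB B0 /= -ltnNge => lt.
  have sub : nbhd r B \subset y |: nbhd r' B.
    apply/subsetP=> z /nbhdP[x Bx rxz]; rewrite !inE; have [//|zy] := eqVneq z y.
    by apply/existsP; exists x; rewrite Bx /r' rxz.
  have := leq_trans lt (subset_leq_card sub).
  by rewrite cardsU1; case: (y \notin _) => //= /ltnW.
exists (fun x => if x == x0 then y else f x); split=> [u v Pu Pv|u Pu] /=.
  have cross w : w \in P -> w != x0 -> f w <> y.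
    move=> Pw wx; have /rf/andP[_ /eqP//] : w \in P :\ x0 by rewrite !inE wx.
  case: eqVneq => [->|ux]; case: eqVneq => [->//|vx] E.
  - by case: (cross v).
  - by case: (cross u).
  - by apply: injf => //; rewrite !inE ?ux ?vx.
by case: eqVneq => [->//|ux]; have /rf/andP[] : u \in P :\ x0 by rewrite !inE ux.
Qed.

End Hall.

(** * Expansion of a level under transpositions *)

Section Expansion.
Variable V : finType.
Local Notation n := #|V|.
Implicit Types (x y : {set V}) (I : {set {set V}}) (g h : {perm V}).

Definition lev (l : nat) : {set {set V}} := [set x : {set V} | #|x| == l].

Lemma card_lev l : #|lev l| = 'C(n, l).
Proof. by rewrite card_draws. Qed.

Lemma imset_permM g h x : (g * h)%g @: x = h @: (g @: x).
Proof. by rewrite -imset_comp; apply: eq_imset => v; rewrite permM. Qed.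

Lemma card_imset_perm g x : #|g @: x| = #|x|.
Proof. by apply: card_imset; apply: perm_inj. Qed.

Lemma perm_transitive_lev x y : #|x| = #|y| -> exists g, g @: x = y.
Proof.
have [k] := ubnP #|x :\: y|; elim: k x => // k IH x ltk cxy.
have [/eqP D0|[i Di]] := set_0Vmem (x :\: y).
  exists 1%g; apply/eqP; rewrite eqEcard card_imset_perm cxy leqnn andbT.
  by rewrite (eq_imset (g := id)) ?imset_id -?setD_eq0 // => v; rewrite perm1.
have [j Dj] : exists j, j \in y :\: x.
  apply/set0Pn; rewrite -card_gt0 cardsD setIC -cxy -cardsD.
  by rewrite card_gt0; apply/set0Pn; exists i.
move: Di Dj; rewrite !inE => /andP[niy ix] /andP[njx jy].
have tx : tperm i j @: x = j |: (x :\ i).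
  apply/setP=> v; rewrite !inE; apply/imsetP/idP.
    case=> u ux ->; case: tpermP => [_|uj|/eqP ui /eqP uj]; rewrite ?eqxx //.
      by rewrite uj (negPf njx) in ux.
    by rewrite ui ux orbT.
  case/orP=> [/eqP->|/andP[vi vx]]; first by exists i; rewrite ?tpermL.
  by exists v => //; rewrite tpermD // eq_sym //; apply: contraNneq njx => <-.
have [||g gE] := IH (tperm i j @: x).
- apply: leq_trans (_ : #|x :\: y| <= k); last by [].
  apply: proper_card; rewrite tx; apply/properP; split.
    apply/subsetP=> v; rewrite !inE => /andP[vy /orP[/eqP vj|/andP[_ ->]]].
      by rewrite vj jy in vy.
    by rewrite vy.
  exists i; rewrite !inE ?niy ?ix //= eqxx /= orbF.
  by apply: contraNneq niy => ->.
- by rewrite card_imset_perm.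
by exists (tperm i j * g)%g; rewrite imset_permM.
Qed.

Definition moved I g := [set x in I | g @: x \notin I].

(** A member of [I] that leaves under [g * h] either leaves already under [g], or is carried by [g]
    to a member of [I] that leaves under [h]. *)
Lemma card_movedM I g h : #|moved I (g * h)%g| <= #|moved I g| + #|moved I h|.
Proof.
have injg : injective (fun x => g @: x) by apply/imset_inj/perm_inj.
rewrite -(card_imset (moved I g) injg).
rewrite -(card_imset (moved I (g * h)%g) injg).
apply: leq_trans (leq_card_setU _ _); apply: subset_leq_card.
apply/subsetP=> _ /imsetP[x + ->]; rewrite !inE imset_permM => /andP[Ix ->].
have [_|gx] := boolP (g @: x \in I); first by rewrite orbT.
by rewrite orbF; apply/imsetP; exists x => //; rewrite inE Ix.
Qed.

(** A permutation is a product of at most as many transpositions as it has non-fixed points, and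
    [moved] is subadditive. The transposition [t] of the proof makes [g'] fix [v] besides all fixed
    points of [g]. *)
Lemma card_moved_le I M g :
  (forall i j, #|moved I (tperm i j)| <= M) -> #|moved I g| <= n * M.
Proof.
move=> leM; suff: #|moved I g| <= #|[set v | g v != v]| * M.
  by move/leq_trans; apply; rewrite leq_mul2r max_card orbT.
have [k] := ubnP #|[set v | g v != v]|; elim: k g => // k IH g ltk.
have [E|[v]] := set_0Vmem [set v | g v != v].
  rewrite E cards0 mul0n leqn0 cards_eq0; apply/eqP/setP=> x; rewrite !inE.
  have -> : g @: x = x.
    rewrite (eq_imset (g := id)) ?imset_id // => v; apply/eqP/negPn/negP=> gv.
    by have /setP/(_ v) := E; rewrite !inE gv.
  by rewrite andbN.
rewrite inE => gv; pose t := tperm (g v) v; pose g' := (g * t)%g.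
have -> : g = (g' * t)%g by rewrite -mulgA tperm2 mulg1.
have lt' : #|[set u | g' u != u]| < #|[set u | g u != u]|.
  apply: proper_card; apply/properP; split; last first.
    by exists v; rewrite !inE ?gv // permM tpermL eqxx.
  apply/subsetP=> u; rewrite !inE; apply: contraNneq => gu.
  rewrite permM gu tpermD //.
    by apply: contraNneq gv => gvu; rewrite -(inj_eq (@perm_inj _ g)) gvu gu.
  by apply: contraNneq gv => ->; apply/eqP.
have E : (g' * t)%g = g by rewrite -mulgA tperm2 mulg1.
apply: leq_trans (card_movedM _ _ _) _; rewrite E.
apply: leq_trans (leq_add (IH g' _) (leM _ _)) _; first exact: leq_trans lt' _.
by rewrite -mulSnr leq_mul2r lt' orbT.
Qed.

(* Averaging over all permutations sends a fixed set of a level to a uniformly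
   distributed one, so some permutation, hence some transposition, moves many
   members of [I] out of [I]. *)
Lemma swap_expansion l I M : I \subset lev l ->
  (forall i j, #|moved I (tperm i j)| <= M) ->
  #|I| * (#|lev l| - #|I|) <= #|lev l| * (n * M).
Proof.
move=> sI leM; pose c x y := #|[set g : {perm V} | g @: x == y]|.
have cE x y y' : #|y| = #|y'| -> c x y <= c x y'.
  move=> /perm_transitive_lev[h hy]; rewrite /c.
  rewrite -(card_imset _ (mulIg h)); apply: subset_leq_card.
  by apply/subsetP=> _ /imsetP[g + ->]; rewrite !inE imset_permM => /eqP->; rewrite hy.
have cK x y : x \in lev l -> y \in lev l -> #|lev l| * c x y = #|{perm V}|.
  rewrite !inE => /eqP xl /eqP yl.
  rewrite -sum_nat_const -[RHS]cardsT -sum1_card.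
  rewrite (partition_big (fun g : {perm V} => g @: x) (mem (lev l))) /=; last first.
    by move=> g _; rewrite inE card_imset_perm xl.
  apply: eq_bigr => z; rewrite inE => /eqP zl; rewrite sum1_card.
  rewrite (_ : c x y = c x z); last by apply/eqP; rewrite eqn_leq !cE ?yl ?zl.
  by apply: eq_card => g; rewrite [in RHS]unfold_in !inE.
have K0 : 0 < #|{perm V}| by rewrite -cardsT card_gt0; apply/set0Pn; exists 1%g; rewrite inE.
rewrite -(leq_pmul2r K0).
have -> : #|I| * (#|lev l| - #|I|) * #|{perm V}| =
    #|lev l| * \sum_(g : {perm V}) #|moved I g|.
  have -> : \sum_(g : {perm V}) #|moved I g| =
      \sum_(x in I) \sum_(y in lev l :\: I) c x y.
    have mE g : #|moved I g| = \sum_(x in I) (g @: x \notin I).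
      rewrite -sum1_card [RHS]big_mkcond [LHS]big_mkcond; apply: eq_bigr => x _ /=.
      by rewrite inE; case: (x \in I).
    rewrite (eq_bigr _ (fun g _ => mE g)).
    rewrite exchange_big /=; apply: eq_bigr => x Ix.
    have c_sum y : c x y = \sum_(g : {perm V}) (g @: x == y).
      by rewrite /c -sum1_card big_mkcond; apply: eq_bigr => g _; rewrite inE.
    rewrite [RHS](eq_bigr _ (fun y _ => c_sum y)).
    rewrite [RHS]exchange_big; apply: eq_bigr => g _ /=.
    have glev : g @: x \in lev l.
      by rewrite inE card_imset_perm; have := subsetP sI _ Ix; rewrite inE.
    have [gI|gI] := boolP (g @: x \notin I).
      rewrite (bigD1 (g @: x)) /=; last by rewrite inE gI glev.
      rewrite eqxx big1 ?addn0 // => y.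
      by rewrite inE => /andP[_ ne]; rewrite eq_sym (negPf ne).
    rewrite big1 // => y; rewrite !inE => /andP[nI _].
    by case: eqP => // E; move: gI; rewrite E nI.
  have cD : #|lev l :\: I| = #|lev l| - #|I| by rewrite cardsD (setIidPr sI).
  rewrite big_distrr (eq_bigr (fun=> #|lev l :\: I| * #|{perm V}|)) /=; last first.
    move=> x Ix; rewrite big_distrr (eq_bigr (fun=> #|{perm V}|)) /=; last first.
      by move=> y /setDP[ly _]; rewrite cK // (subsetP sI).
    by rewrite sum_nat_const.
  by rewrite sum_nat_const cD mulnA.
apply: leq_trans (_ : #|lev l| * \sum_(g : {perm V}) (n * M) <= _).
  by rewrite leq_mul2l leq_sum ?orbT // => g _; apply: card_moved_le.
by rewrite sum_nat_const -mulnA [_ * #|{perm V}|]mulnC mulnA.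
Qed.
End Expansion.

(** * Edge counting in biregular graphs *)

Section DoubleCounting.
Variables (R : realFieldType) (A B : finType).
Implicit Types (X Z : {set A}) (Y S W : {set B}) (e : A -> B -> bool).

Lemma card_edges e X Y :
  \sum_(x in X) #|[set y in Y | e x y]| = \sum_(y in Y) #|[set x in X | e x y]|.
Proof.
have eL x : #|[set y in Y | e x y]| = \sum_(y in Y) e x y.
  rewrite -sum1_card big_mkcond [RHS]big_mkcond; apply: eq_bigr => y _.
  by rewrite inE; case: (y \in Y).
have eR y : #|[set x in X | e x y]| = \sum_(x in X) e x y.
  rewrite -sum1_card big_mkcond [RHS]big_mkcond; apply: eq_bigr => x _.
  by rewrite inE; case: (x \in X).
rewrite (eq_bigr _ (fun x _ => eL x)) exchange_big /=.
by apply: eq_bigr => y _; rewrite eR.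
Qed.

(** Counting the edges between [Z] and [S] gives [#|S :&: W| >= z (#|S| - eta)]; counting those
    between [X :\: Z] and [S :\: W] gives [#|S :\: W| <= (1 - z) (#|S| + eta)]. The first loses
    [z * eta], the second [(1 - z) * eta], and the smaller of the two is at most [2 z (1 - z) eta].
    Using both counts is what makes the loss vanish at [z = 0] and at [z = 1]. *)
Lemma biregular_density e X Y S W Z (dX dY : nat) (eta z : R) :
  0 < #|X| -> 0 < dX ->
  {in X, forall x, #|[set y in Y | e x y]| = dX} ->
  {in Y, forall y, #|[set x in X | e x y]| = dY} ->
  S \subset Y -> (0 <= eta)%R ->
  {in X, forall x, (`| #|[set y in S | e x y]|%:R * #|Y|%:R - #|S|%:R * dX%:R |
                     <= eta * dX%:R)%R} ->
  Z \subset X -> (forall x y, x \in Z -> y \in Y -> e x y -> y \in W) ->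
  (0 <= z)%R -> (z * #|X|%:R <= #|Z|%:R)%R ->
  (z * #|S|%:R - 2 * z * (1 - z) * eta <= #|S :&: W|%:R)%R.
Proof.
move=> X0 dX0 degX degY sSY eta0 balS sZX cl z0 zX.
have eXY : #|X| * dX = #|Y| * dY.
  rewrite -[LHS]sum_nat_const -[RHS]sum_nat_const.
  rewrite -(eq_bigr _ degX) -(eq_bigr _ degY); exact: card_edges.
have e1 : \sum_(x in Z) #|[set y in S | e x y]| <= #|S :&: W| * dY.
  rewrite card_edges (big_setID W) /= [X in _ + X]big1 ?addn0; last first.
    move=> y /setDP[Sy nWy]; apply/eqP; rewrite cards_eq0; apply/eqP/setP=> x.
    rewrite !inE; apply/negP=> /andP[Zx exy].
    by rewrite (cl x y Zx) ?(subsetP sSY) in nWy.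
  rewrite -sum_nat_const leq_sum // => y /setIP[Sy _].
  rewrite -(degY y) ?(subsetP sSY) // subset_leq_card //.
  by apply/subsetP=> x; rewrite !inE => /andP[/(subsetP sZX)-> ->].
have e2 : #|S :\: W| * dY <= \sum_(x in X :\: Z) #|[set y in S | e x y]|.
  rewrite card_edges [X in _ <= X](big_setID W) /=.
  apply: leq_trans (leq_addl _ _); rewrite -sum_nat_const leq_sum // => y /setDP[Sy nWy].
  rewrite -(degY y) ?(subsetP sSY) // subset_leq_card //.
  apply/subsetP=> x; rewrite !inE => /andP[-> exy]; rewrite exy !andbT.
  by apply: contra nWy => Zx; apply: cl exy; rewrite ?(subsetP sSY).
pose s : R := (#|S|%:R)%R; pose xx : R := (#|X|%:R)%R; pose yy : R := (#|Y|%:R)%R.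
pose d : R := (dX%:R)%R; pose d' : R := (dY%:R)%R.
have d0 : (0 < d)%R by rewrite ltr0n.
have xx0 : (0 < xx)%R by rewrite ltr0n.
have s0 : (0 <= s)%R by rewrite ler0n.
have exy : (xx * d = yy * d')%R by rewrite -!natrM eXY.
have zcard : (#|Z|%:R <= xx)%R by rewrite ler_nat subset_leq_card.
have z1 : (z <= 1)%R by rewrite -(ler_pM2r xx0) mul1r (le_trans zX).
have sumc (D : {set A}) (a : R) : (#|D|%:R * a = \sum_(x in D) a)%R.
  by rewrite sumr_const mulr_natl.
have r1 : (#|Z|%:R * (s - eta) <= #|S :&: W|%:R * xx)%R.
  rewrite -(ler_pM2r d0).
  have -> : (#|S :&: W|%:R * xx * d = (#|S :&: W| * dY)%:R * yy)%R.
    by rewrite natrM -mulrA exy -mulrA [(yy * _)%R]mulrC.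
  apply: (@le_trans _ _ ((\sum_(x in Z) #|[set y in S | e x y]|)%:R * yy)%R).
    rewrite -mulrA sumc natr_sum [leRHS]big_distrl /=.
    apply: ler_sum => x /(subsetP sZX)/balS; rewrite ler_norml -/s -/d -/yy; lra.
  by rewrite ler_wpM2r ?ler0n // ler_nat.
have r2 : (#|S :\: W|%:R * xx <= (xx - #|Z|%:R) * (s + eta))%R.
  rewrite -(ler_pM2r d0).
  have -> : (#|S :\: W|%:R * xx * d = (#|S :\: W| * dY)%:R * yy)%R.
    by rewrite natrM -mulrA exy -mulrA [(yy * _)%R]mulrC.
  apply: (@le_trans _ _ ((\sum_(x in X :\: Z) #|[set y in S | e x y]|)%:R * yy)%R).
    by rewrite ler_wpM2r ?ler0n // ler_nat.
  have -> : (xx - #|Z|%:R = #|X :\: Z|%:R :> R)%R.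
    by rewrite cardsD (setIidPr sZX) natrB // subset_leq_card.
  rewrite -mulrA sumc natr_sum [leLHS]big_distrl /=.
  apply: ler_sum => x /setDP[/balS + _]; rewrite ler_norml -/s -/d -/yy; lra.
have cS : (#|S :\: W|%:R = s - #|S :&: W|%:R :> R)%R.
  by rewrite cardsD natrB // subset_leq_card // subsetIl.
rewrite -/s -(ler_pM2r xx0); rewrite cS in r2.
set p : R := (#|S :&: W|%:R)%R in r1 r2 *; set q : R := (#|Z|%:R)%R in zX zcard r1 r2.
have p0 : (0 <= p)%R by rewrite ler0n.
have le1 : (z * (s - eta) * xx <= p * xx)%R.
  case: (lerP eta s) => h; last first.
    apply: (@le_trans _ _ 0%R); last by rewrite mulr_ge0 // ltW.
    by rewrite mulr_le0_ge0 ?(ltW xx0) // mulr_ge0_le0 // subr_le0 ltW.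
  by apply: le_trans r1; rewrite mulrAC ler_wpM2r // subr_ge0.
have le2 : ((s - p) * xx <= (1 - z) * (s + eta) * xx)%R.
  apply: le_trans r2 _; rewrite mulrAC ler_wpM2r ?addr_ge0 //; lra.
have h3 : (0 <= eta * xx)%R by rewrite mulr_ge0 // ltW.
(* For [z <= 1 / 2] the bound [le1] is the better one, since [z <= 2 z (1 - z)]; otherwise [le2]
   is. *)
case: (lerP z (1 / 2)) => hz.
  have : (0 <= z * (1 - 2 * z) * (eta * xx))%R by rewrite !mulr_ge0 //; lra.
  by move=> h4; nra.
have : (0 <= (1 - z) * (2 * z - 1) * (eta * xx))%R by rewrite !mulr_ge0 //; lra.
by move=> h4; nra.
Qed.

End DoubleCounting.

(** * Level densities of up-sets and balanced parts of a level *)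

Section Density.
Variables (R : realFieldType) (V : finType).
Local Notation n := #|V|.
Implicit Types (x y : {set V}) (I S : {set {set V}}) (g h l k : nat).

Definition upset I := forall x y, x \subset y -> x \in I -> y \in I.

Lemma card_lev_sub y h : #|[set x in lev V h | x \subset y]| = 'C(#|y|, h).
Proof.
by rewrite -cards_draws; apply: eq_card => x; rewrite !inE andbC.
Qed.

Lemma card_lev_super x l : #|x| <= l <= n ->
  #|[set y in lev V l | x \subset y]| = 'C(n - #|x|, l - #|x|).
Proof.
move=> /andP[xl ln]; rewrite -bin_sub ?leq_sub2r //.
have -> : n - #|x| - (l - #|x|) = n - l by lia.
have <- : #|~: x| = n - #|x| by rewrite -(cardsC x) addKn.
rewrite -card_lev_sub -(card_imset _ (can_inj (@setCK V))).
apply: eq_card => y; rewrite !inE; apply/imsetP/andP.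
  case=> u; rewrite !inE => /andP[/eqP ul xu] ->; rewrite setCS xu.
  by have := cardsC u; rewrite ul; split=> //; apply/eqP; lia.
case=> /eqP yl yx; exists (~: y); rewrite ?setCK // !inE -setCS setCK yx andbT.
by have := cardsC y; rewrite yl => E; apply/eqP; lia.
Qed.

Definition dens I h : R := (#|I :&: lev V h|%:R / 'C(n, h)%:R)%R.

Lemma dens_bin I h : h <= n -> (dens I h * 'C(n, h)%:R = #|I :&: lev V h|%:R)%R.
Proof. by move=> hn; rewrite divfK // pnatr_eq0 -lt0n bin_gt0. Qed.

Lemma dens_ge0 I h : (0 <= dens I h)%R.
Proof. by rewrite divr_ge0 ?ler0n. Qed.

Lemma dens_le1 I h : (dens I h <= 1)%R.
Proof.
rewrite /dens; have [hn|hn] := leqP h n; last by rewrite bin_small // invr0 mulr0.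
rewrite ler_pdivrMr ?ltr0n ?bin_gt0 // mul1r ler_nat -card_lev.
by rewrite subset_leq_card // subsetIr.
Qed.

Lemma dens_setC I h : h <= n -> (dens (~: I) h = 1 - dens I h)%R.
Proof.
move=> hn; have b0 : ('C(n, h)%:R != 0 :> R)%R by rewrite pnatr_eq0 -lt0n bin_gt0.
apply: (mulIf b0); rewrite mulrBl !dens_bin // mul1r -card_lev.
have := cardsID I (lev V h); rewrite setIC => <-.
by rewrite natrD setIC -setDE addrC addKr.
Qed.

(** Cleared of denominators: each vertex at distance exactly [k] above or below level [l] sees the
    share [#|S| / 'C(n, l)] of its comparable vertices in [S], up to [eta / 'C(n, l)]. Thus [eta] is
    measured in vertices of the level. The symmetric comparability relation treats both sides at
    once. *)
Definition balanced k (eta : R) S l := forall x : {set V},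
  (#|x| + k == l) || (#|x| == l + k) ->
  (`| #|[set y in S | (x \subset y) || (y \subset x)]|%:R * 'C(n, l)%:R -
      #|S|%:R * #|[set y in lev V l | (x \subset y) || (y \subset x)]|%:R |
   <= eta * #|[set y in lev V l | (x \subset y) || (y \subset x)]|%:R)%R.

Lemma balancedD k eta S l : S \subset lev V l -> balanced k eta S l ->
  balanced k eta (lev V l :\: S) l.
Proof.
move=> sS bal x /bal; set N := [set y in lev V l | _]; set M := [set y in S | _].
have sMN : M \subset N.
  by apply/subsetP=> y; rewrite !inE => /andP[/(subsetP sS)]; rewrite inE => -> ->.
have -> : [set y in lev V l :\: S | (x \subset y) || (y \subset x)] = N :\: M.
  by apply/setP=> y; rewrite !inE; case: (y \in S); case: (_ || _); rewrite ?andbF.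
rewrite !cardsD (setIidPr sS) (setIidPr sMN) -card_lev !natrB ?subset_leq_card //.
by rewrite -normrN; congr (`|_| <= _)%R; ring.
Qed.

Lemma cmp_sub x y : #|x| <= #|y| -> (x \subset y) || (y \subset x) = (x \subset y).
Proof.
move=> le; have [//|nxy /=] := boolP (x \subset y); apply/negbTE.
by apply: contra nxy => yx; have /eqP-> : y == x by rewrite eqEcard yx.
Qed.

Lemma biregular_lev_up h l : h <= l <= n ->
  [/\ 0 < #|lev V h|, 0 < 'C(n - h, l - h),
      {in lev V h, forall x, #|[set y in lev V l | x \subset y]| = 'C(n - h, l - h)}
    & {in lev V l, forall y, #|[set x in lev V h | x \subset y]| = 'C(l, h)}].
Proof.
move=> /andP[hl ln]; split=> [|||y].
- by rewrite card_lev bin_gt0 (leq_trans hl).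
- by rewrite bin_gt0 leq_sub2r.
- by move=> x; rewrite inE => /eqP xh; rewrite card_lev_super xh ?hl.
- by rewrite inE => /eqP<-; rewrite card_lev_sub.
Qed.

(** The normalized matching property: a full level is balanced with error [0], so
    [biregular_density] is lossless. *)
Lemma dens_mono I h l : upset I -> h <= l <= n -> (dens I h <= dens I l)%R.
Proof.
move=> upI hln; have [h0 d0 dU dD] := biregular_lev_up hln.
have [hl ln] := andP hln; have hn := leq_trans hl ln.
have := @biregular_density R _ _ _ _ _ (lev V l) I (I :&: lev V h) _ _ 0%R (dens I h)
  h0 d0 dU dD (subxx _) (lexx _).
rewrite mulr0 subr0 mul0r => H.
have b0 : (0 < 'C(n, l)%:R :> R)%R by rewrite ltr0n bin_gt0.
rewrite -(ler_pM2r b0) dens_bin // -card_lev setIC; apply: H.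
- by move=> x xh; rewrite dU // mulrC subrr normr0.
- exact: subsetIr.
- by move=> x y /setIP[Ix _] _ xy; apply: upI xy Ix.
- exact: dens_ge0.
- by rewrite card_lev dens_bin.
Qed.

(** Balance speaks only of vertices at distance exactly [k], so the edges start at level [l - k];
    monotonicity of the density then allows any lower reference level [h]. *)
Lemma balanced_lower k eta S l I h : S \subset lev V l -> l <= n -> (0 <= eta)%R ->
  balanced k eta S l -> upset I -> h + k <= l ->
  (dens I h * #|S|%:R - 2 * dens I h * (1 - dens I h) * eta <= #|S :&: I|%:R)%R.
Proof.
move=> sS ln eta0 bal upI hkl.
have hln : l - k <= l <= n by rewrite leq_subr.
have [h0 d0 dU dD] := biregular_lev_up hln.
apply: (@biregular_density R _ _ _ _ _ S I (I :&: lev V (l - k)) _ _ eta (dens I h)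
  h0 d0 dU dD sS eta0).
- move=> x xl; have := xl; rewrite inE => /eqP xlk.
  have xlE : #|x| <= l by rewrite xlk leq_subr.
  have := bal x; rewrite xlk subnK ?eqxx; last by apply: leq_trans hkl; apply: leq_addl.
  move=> /(_ isT); rewrite card_lev -(dU x) //.
  have E (T : {set {set V}}) : T \subset lev V l ->
      [set y in T | (x \subset y) || (y \subset x)] = [set y in T | x \subset y].
    move=> sT; apply/setP=> y; rewrite !inE; have [Ty|//] := boolP (y \in T).
    by rewrite /= cmp_sub //; have := subsetP sT _ Ty; rewrite inE => /eqP->.
  by rewrite !E.
- exact: subsetIr.
- by move=> x y /setIP[Ix _] _ xy; apply: upI xy Ix.
- exact: dens_ge0.
- rewrite card_lev -(dens_bin I) ?(leq_trans (leq_subr _ _)) //.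
  by rewrite ler_wpM2r ?ler0n // dens_mono //; apply/andP; split; lia.
Qed.

Lemma biregular_lev_down h l : l <= h <= n ->
  [/\ 0 < #|lev V h|, 0 < 'C(h, l),
      {in lev V h, forall x, #|[set y in lev V l | y \subset x]| = 'C(h, l)}
    & {in lev V l, forall y, #|[set x in lev V h | y \subset x]| = 'C(n - l, h - l)}].
Proof.
move=> /andP[lh hn]; split.
- by rewrite card_lev bin_gt0.
- by rewrite bin_gt0.
- by move=> x; rewrite inE => /eqP<-; rewrite card_lev_sub.
- by move=> y; rewrite inE => /eqP yl; rewrite card_lev_super yl ?lh.
Qed.

(** The same edge count applied to [~: I], which is closed downwards, from level [l + k]. The error
    keeps its form because [z (1 - z)] is invariant under complement. *)
Lemma balanced_upper k eta S l I h : S \subset lev V l -> (0 <= eta)%R ->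
  balanced k eta S l -> upset I -> l + k <= h <= n ->
  (#|S :&: I|%:R <= dens I h * #|S|%:R + 2 * dens I h * (1 - dens I h) * eta)%R.
Proof.
move=> sS eta0 bal upI /andP[lkh hn].
have lkn := leq_trans lkh hn.
have hln : l <= l + k <= n by rewrite leq_addr.
have [h0 d0 dU dD] := biregular_lev_down hln.
have := @biregular_density R _ _ _ _ _ S (~: I) (~: I :&: lev V (l + k)) _ _ eta
  (1 - dens I h)%R h0 d0 dU dD sS eta0.
have -> : (#|S :&: ~: I|%:R = #|S|%:R - #|S :&: I|%:R :> R)%R.
  by rewrite -(cardsID I S) natrD addrC addKr setDE.
move=> H; suff : ((1 - dens I h) * #|S|%:R -
    2 * (1 - dens I h) * (1 - (1 - dens I h)) * eta <= #|S|%:R - #|S :&: I|%:R)%R.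
  by move: (dens I h) => z; lra.
apply: H.
- move=> x xl; have := xl; rewrite inE => /eqP xlk.
  have xlE : l <= #|x| by rewrite xlk leq_addr.
  have := bal x; rewrite xlk eqxx orbT.
  move=> /(_ isT); rewrite card_lev -(dU x) //.
  have E (T : {set {set V}}) : T \subset lev V l ->
      [set y in T | (x \subset y) || (y \subset x)] = [set y in T | y \subset x].
    move=> sT; apply/setP=> y; rewrite !inE; have [Ty|//] := boolP (y \in T).
    by rewrite /= orbC cmp_sub //; have := subsetP sT _ Ty; rewrite inE => /eqP->.
  by rewrite !E.
- exact: subsetIr.
- by move=> x y; rewrite !inE => /andP[nIx _] _ yx; apply: contra nIx; apply: upI.
- by rewrite subr_ge0 dens_le1.
- rewrite card_lev -(dens_bin (~: I)) // dens_setC //.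
  by rewrite ler_wpM2r ?ler0n // lerB // dens_mono // lkh.
Qed.

End Density.

(** * Quantitative growth of the density from one level to the next *)

Section Growth.
Variables (R : realFieldType) (V : finType).
Local Notation n := #|V|.
Local Notation dens := (@dens R V).
Implicit Types (x y : {set V}) (I S : {set {set V}}) (g h l k : nat).

(* A transposition moving [x] out of [I] yields the edge from its image, outside
   [I], to their union, inside [I]; such edges are what makes the density grow. *)
Lemma card_moved_edges I h i j : upset I -> h < n ->
  #|I :&: lev V h| * (n - h) + #|moved (I :&: lev V h) (tperm i j)| <=
  #|I :&: lev V h.+1| * h.+1.
Proof.
move=> upI hn; set J := I :&: lev V h; set K := I :&: lev V h.+1.
have hln : h <= h.+1 <= n by rewrite leqnSn hn.
have [_ _ dU dD] := biregular_lev_up hln.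
have -> : #|K| * h.+1 = \sum_(x in lev V h) #|[set y in K | x \subset y]|.
  rewrite card_edges -sum_nat_const; apply: eq_bigr => y /setIP[_ ly].
  by rewrite dD // binSn.
rewrite (big_setID J) /= (setIidPr (subsetIr _ _)); apply: leq_add.
  rewrite -sum_nat_const; apply: leq_sum => x /setIP[Ix lx].
  rewrite -[n - h]bin1 -(subSnn h) -(dU x) // subset_leq_card //.
  apply/subsetP=> y; rewrite !inE => /andP[-> xy]; rewrite xy (upI x) //.
set t := tperm i j; have injt : injective (fun x : {set V} => t @: x).
  by apply/imset_inj/perm_inj.
rewrite -(card_imset (moved J t) injt) -sum1_card.
pose tM := (fun x : {set V} => t @: x) @: moved J t.
have sub : tM \subset lev V h :\: J.
  apply/subsetP=> _ /imsetP[x mx ->]; move: mx; rewrite inE => /andP[/setIP[_ xh] tx].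
  by rewrite in_setD tx /=; move: xh; rewrite !inE card_imset_perm.
rewrite [X in _ <= X](big_setID tM) /= (setIidPr sub).
apply: leq_trans (leq_addr _ _); apply: leq_sum => _ /imsetP[x mx ->].
move: mx; rewrite inE => /andP[/setIP[Ix lx] tx]; rewrite card_gt0; apply/set0Pn.
have xh : #|x| = h by apply/eqP; move: lx; rewrite inE.
have [v sv] : exists v, t @: x \subset v |: x.
  have [ix|ix] := boolP (i \in x); [exists j|exists i]; apply/subsetP=> _ /imsetP[u ux ->];
    rewrite !inE; case: tpermP => [ui|uj|/eqP ui /eqP uj]; rewrite ?eqxx ?ix ?ux ?orbT //.
  by rewrite -ui ux in ix.
exists (x :|: t @: x); rewrite !inE subsetUr (upI x) ?subsetUl //= andbT.
rewrite eqn_leq; apply/andP; split.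
  apply: leq_trans (subset_leq_card (_ : _ \subset v |: x)) _.
    by rewrite subUset subsetU1.
  by rewrite cardsU1 xh; case: (v \notin x).
rewrite -[in h.+1]xh; apply: proper_card; rewrite properE subsetUl subUset subxx /=.
apply: contra tx => tsx; have /eqP-> : t @: x == x.
  by rewrite eqEcard tsx card_imset_perm leqnn.
by rewrite inE Ix lx.
Qed.

(** By [card_moved_edges] each transposition moves at most [M = #|K| * h.+1 - #|J| * (n - h)]
    members of [J] out of [J]. Since ['C(n, h.+1) * h.+1 = 'C(n, h) * (n - h)], this [M] is
    ['C(n, h) (n - h)] times the increase of the density, and [swap_expansion] turns it into
    [z (1 - z) <= n (n - h) (z' - z)]. *)
Lemma dens_growth I h : upset I -> h < n ->
  (dens I h * (1 - dens I h) <= n%:R ^+ 2 * (dens I h.+1 - dens I h))%R.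
Proof.
move=> upI hn; set J := I :&: lev V h; set K := I :&: lev V h.+1.
have hn' := ltnW hn.
have leJ : #|J| <= #|lev V h| by rewrite subset_leq_card // subsetIr.
have le0 i j := @card_moved_edges I h i j upI hn.
have leK : #|J| * (n - h) <= #|K| * h.+1.
  have /card_gt0P[i _] : 0 < n by apply: leq_ltn_trans hn.
  exact: leq_trans (leq_addr _ _) (le0 i i).
have leM i j : #|moved J (tperm i j)| <= #|K| * h.+1 - #|J| * (n - h).
  by rewrite leq_subRL.
have := swap_expansion (subsetIr _ _) leM.
rewrite -(ler_nat R) !natrM !natrB // !natrM card_lev -!dens_bin // natrB //.
set w : R := ('C(n, h)%:R)%R; set w' : R := ('C(n, h.+1)%:R)%R.
have w0 : (0 < w)%R by rewrite ltr0n bin_gt0.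
have ww : (w' * h.+1%:R = w * (n%:R - h%:R))%R.
  by rewrite -natrB // -!natrM mulnC mul_bin_left mulnC.
move: (dens I h) (dens I h.+1) (dens_ge0 R I h) (dens_le1 R I h) => z z' z0 z1.
rewrite -[(z' * _ * _)%R]mulrA ww => le1.
have hN : (0 <= (n%:R - h%:R : R) <= n%:R)%R.
  by rewrite subr_ge0 ler_nat hn' lerBlDr lerDl ler0n.
have n0 : (0 < n%:R :> R)%R by rewrite ltr0n (leq_ltn_trans _ hn).
have le2 : (z * (1 - z) <= n%:R * (n%:R - h%:R) * (z' - z))%R.
  rewrite -(ler_pM2l (mulr_gt0 w0 w0)); move: le1; lra.
have zz : (0 <= z' - z)%R.
  have d0 : (0 < (n%:R * (n%:R - h%:R) : R))%R by rewrite mulr_gt0 // subr_gt0 ltr_nat.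
  rewrite -(pmulr_rge0 _ d0); apply: le_trans le2.
  by rewrite mulr_ge0 // subr_ge0.
apply: le_trans le2 _; apply: ler_wpM2r => //.
by rewrite expr2 ler_wpM2l ?ler0n //; case/andP: hN.
Qed.
End Growth.

(** * Exponential moments of a random subset of prescribed size *)

Section FirstMoment.
Variables (R : realType) (U : finType).
Implicit Types (W N S J : {set U}).

(** Cross-multiplied: a uniform [s]-subset of a [w]-set contains a given [j]-set with probability at
    most [(s / w) ^ j], the value for independent draws. *)
Lemma bin_diag_le (w s j : nat) : j <= s <= w ->
  'C(w - j, s - j) * w ^ j <= 'C(w, s) * s ^ j.
Proof.
case/andP=> js sw; elim: j js => [|j IH] js; first by rewrite !subn0 !expn0.
have wj : 0 < w - j by lia.
have E : (w - j) * 'C(w - j.+1, s - j.+1) = (s - j) * 'C(w - j, s - j).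
  have := mul_bin_diag (w - j) (s - j.+1).
  by rewrite -subnS => ->; congr (_ * 'C(_, _)); lia.
have {}IH := IH (ltnW js).
rewrite -(leq_pmul2l wj) mulnA E !expnS.
have h1 : (s - j) * w <= (w - j) * s by nia.
have -> : (s - j) * 'C(w - j, s - j) * (w * w ^ j) =
    (s - j) * w * ('C(w - j, s - j) * w ^ j) by ring.
have -> : (w - j) * ('C(w, s) * (s * s ^ j)) = (w - j) * s * ('C(w, s) * s ^ j) by ring.
exact: leq_mul.
Qed.

Lemma card_draws_super W J s : J \subset W ->
  #|[set S : {set U} | (S \subset W) && (#|S| == s) & J \subset S]| <=
  if #|J| <= s then 'C(#|W| - #|J|, s - #|J|) else 0.
Proof.
move=> sJW; case: ifPn => [Js|]; last first.
  rewrite -ltnNge leqn0 cards_eq0 => sJ; apply/eqP/setP=> S; rewrite !inE.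
  apply/negP=> /andP[/andP[_ /eqP cS] /subset_leq_card]; lia.
have <- : #|W :\: J| = #|W| - #|J| by rewrite cardsD (setIidPr sJW).
rewrite -cards_draws.
rewrite -(@card_in_imset _ _ (fun S => S :\: J)); last first.
  move=> S S'; rewrite !inE => /andP[_ JS] /andP[_ JS'] E.
  by rewrite -(setID S J) -(setID S' J) E (setIidPr JS) (setIidPr JS').
apply: subset_leq_card; apply/subsetP=> _ /imsetP[S + ->].
rewrite !inE => /andP[/andP[SW /eqP cS] JS].
by rewrite setSD // cardsD (setIidPr JS) cS eqxx.
Qed.

Lemma sum_subset_expr N (a : R) :
  (\sum_(J : {set U} | J \subset N) a ^+ #|J| = (1 + a) ^+ #|N|)%R.
Proof.
rewrite exprDn (partition_big (fun J : {set U} => inord #|J| : 'I_#|N|.+1) predT) //=.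
apply: eq_bigr => i _; rewrite expr1n mul1r.
rewrite (eq_bigl (fun J => J \in [set J : {set U} | J \subset N & #|J| == i])) => [|J].
  rewrite (eq_bigr (fun=> a ^+ i)%R); last by move=> J; rewrite inE => /andP[_ /eqP ->].
  by rewrite sumr_const cards_draws.
rewrite !inE; have [sJ|//] := boolP (J \subset N); rewrite /= -val_eqE /= inordK //.
by rewrite ltnS subset_leq_card.
Qed.

(** Expanding [(1 + c) ^+ #|N :&: S|] over the subsets [J] of [N :&: S] leaves the probabilities of
    [J \subset S]; bounding them as for independent draws and resumming gives the binomial moment
    generating function. *)
Lemma first_moment W N s (c : R) : N \subset W -> s <= #|W| -> (0 <= c)%R ->
  (\sum_(S : {set U} | (S \subset W) && (#|S| == s)) (1 + c) ^+ #|N :&: S| <=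
   'C(#|W|, s)%:R * (1 + c * (s%:R / #|W|%:R)) ^+ #|N|)%R.
Proof.
move=> sNW sW c0; set b := (s%:R / #|W|%:R)%R.
have -> : (\sum_(S : {set U} | (S \subset W) && (#|S| == s)) (1 + c) ^+ #|N :&: S| =
    \sum_(J : {set U} | J \subset N)
       c ^+ #|J| *+ #|[set S : {set U} | (S \subset W) && (#|S| == s) & J \subset S]|)%R.
  under eq_bigr => S _ do rewrite -sum_subset_expr.
  rewrite (exchange_big_dep (fun J : {set U} => J \subset N)) /=; last first.
    by move=> S J _; rewrite subsetI => /andP[].
  apply: eq_bigr => J sJ; rewrite -sumr_const; apply: eq_bigl => S.
  by rewrite !inE subsetI sJ.
rewrite -sum_subset_expr big_distrr /=; apply: ler_sum => J sJN.
have sJW := subset_trans sJN sNW.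
have b0 : (0 <= b)%R by rewrite divr_ge0 ?ler0n.
rewrite -[leLHS]mulr_natr exprMn [leRHS]mulrCA ler_wpM2l ?exprn_ge0 //.
apply: le_trans (_ : (if #|J| <= s then 'C(#|W| - #|J|, s - #|J|) else 0)%N%:R <= _)%R.
  by rewrite ler_nat card_draws_super.
case: ifPn => [Js|_]; last by rewrite mulr_ge0 ?ler0n ?exprn_ge0.
have [W0|W0] := posnP #|W|.
  have -> : #|J| = 0 by have := subset_leq_card sJW; rewrite W0 leqn0 => /eqP.
  by rewrite !subn0 expr0 mulr1.
rewrite /b expr_div_n mulrA ler_pdivlMr ?exprn_gt0 ?ltr0n // -!natrX -!natrM ler_nat.
by apply: bin_diag_le; rewrite Js.
Qed.

(** [W :\: S] is a uniform subset of size [#|W| - s]. This version serves the lower tail of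
    [#|N :&: S|]. *)
Lemma first_momentC W N s (c : R) : N \subset W -> s <= #|W| -> (0 <= c)%R ->
  (\sum_(S : {set U} | (S \subset W) && (#|S| == s)) (1 + c) ^+ #|N :\: S| <=
   'C(#|W|, s)%:R * (1 + c * ((#|W| - s)%:R / #|W|%:R)) ^+ #|N|)%R.
Proof.
move=> sNW sW c0; rewrite -bin_sub //.
apply: le_trans (first_moment sNW (leq_subr s _) c0).
have invW (S : {set U}) : S \subset W -> W :\: (W :\: S) = S.
  by move=> SW; rewrite setDDr setDv set0U (setIidPr SW).
rewrite (reindex_onto (fun S => W :\: S) (fun S => W :\: S)) /=; last first.
  by move=> S /andP[/invW].
rewrite le_eqVlt; apply/orP; left; apply/eqP; apply: eq_big => [S|S].
  apply/andP/andP=> [[/andP[_ cS] /eqP E]|[SW /eqP cS]].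
    split; first by rewrite -E subsetDl.
    rewrite -E cardsD (setIidPr (subsetDl _ _)) (eqP cS) //.
  by rewrite subsetDl invW // cardsD (setIidPr SW) cS subKn // !eqxx.
move=> /andP[_ /eqP E]; congr (_ ^+ #|pred_of_set _|)%R.
by rewrite setDDr (_ : N :\: W = set0) ?set0U //; apply/eqP; rewrite setD_eq0.
Qed.

End FirstMoment.

(** * Existence of subsets of low discrepancy *)

Section Discrepancy.
Variable R : realType.
Local Open Scope ring_scope.

(** The Chernoff estimate with the probability stripped off: [K] bounds the normalized exponential
    moment. It rests on [expR (c - c ^+ 2) <= 1 + c] and [1 + c * b <= expR (c * b)] for
    [c = eps / 4]. *)
Lemma chernoff_tail (a d : nat) (K b eps : R) :
  0 <= b <= 1 -> 0 < eps <= 1 -> K < expR (eps ^+ 2 * d%:R / 8) ->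
  (1 + eps / 4) ^+ a <= K * (1 + eps / 4 * b) ^+ d ->
  a%:R <= (b + eps) * d%:R.
Proof.
move=> /andP[b0 b1] /andP[e0 e1] ltK le; set c := eps / 4 in le.
have c0 : 0 < c by rewrite divr_gt0.
have c1 : c <= 1 / 4 by rewrite /c; lra.
have low : expR ((c - c ^+ 2) * a%:R) <= (1 + c) ^+ a.
  rewrite expRM_natr lerXn2r ?nnegrE ?expR_ge0 //; first by lra.
  have := expR_ge1Dx (- (c - c ^+ 2)); rewrite expRN => h.
  have e0' := expR_gt0 (c - c ^+ 2).
  rewrite -[leLHS]invrK invf_ple ?posrE ?invr_gt0 //; last by lra.
  apply: le_trans h; rewrite -[leLHS]mul1r ler_pdivrMr; last by lra.
  nra.
have up : (1 + c * b) ^+ d <= expR (c * b * d%:R).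
  rewrite expRM_natr lerXn2r ?nnegrE ?expR_ge0 ?expR_ge1Dx //.
  by rewrite addr_ge0 // mulr_ge0 // ltW.
have K0 : 0 < (1 + c * b) ^+ d by rewrite exprn_gt0 // ltr_pwDl // mulr_ge0 // ltW.
have : expR ((c - c ^+ 2) * a%:R) < expR (eps ^+ 2 * d%:R / 8 + c * b * d%:R).
  apply: le_lt_trans (le_trans low le) _; rewrite expRD.
  apply: lt_le_trans (_ : expR (eps ^+ 2 * d%:R / 8) * (1 + c * b) ^+ d <= _).
    by rewrite ltr_pM2r.
  by rewrite ler_pM2l ?expR_gt0.
rewrite ltr_expR => lt; rewrite leNgt; apply/negP=> lta.
have d0 : 0 <= d%:R :> R by rewrite ler0n.
have cc : 0 < c - c ^+ 2 by nra.
have : (c - c ^+ 2) * ((b + eps) * d%:R) < (c - c ^+ 2) * a%:R by rewrite ltr_pM2l.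
move=> lt2; have {lt lt2 lta} := lt_trans lt2 lt.
apply/negP; rewrite -leNgt.
have -> : eps ^+ 2 * d%:R / 8 + c * b * d%:R = (eps ^+ 2 / 8 + c * b) * d%:R by ring.
(* Here [c * eps = eps ^+ 2 / 4], and [c ^+ 2 * (b + eps) <= eps ^+ 2 / 8] because [b] and [eps] are
   at most [1]. *)
rewrite mulrA ler_wpM2r // /c; nra.
Qed.

(** The normalized moments of both tails, summed over [X], average to at most [2 * #|X|] over all
    [S]. Some [S] attains this bound; as the summands are nonnegative, each is then at most
    [2 * #|X|], which is the [K] passed to [chernoff_tail]. *)
Lemma low_discrepancy (A U : finType) (X : {set A}) (N : A -> {set U})
    (W : {set U}) (s : nat) (eps : R) :
  (s <= #|W|)%N -> {in X, forall x, N x \subset W} -> 0 < eps <= 1 ->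
  {in X, forall x, 2 * #|X|%:R < expR (eps ^+ 2 * #|N x|%:R / 8)} ->
  exists S : {set U}, [/\ S \subset W, #|S| = s & {in X, forall x,
    `| #|N x :&: S|%:R * #|W|%:R - s%:R * #|N x|%:R |
       <= eps * #|W|%:R * #|N x|%:R}].
Proof.
move=> sW sN /andP[e0 e1] big; pose c := eps / 4.
have c0 : 0 <= c by rewrite divr_ge0 // ltW.
pose w : R := #|W|%:R; pose b := s%:R / w; pose b' := (#|W| - s)%N%:R / w.
have b0 : 0 <= b by rewrite divr_ge0 ?ler0n.
have b0' : 0 <= b' by rewrite divr_ge0 ?ler0n.
have pos (u : R) x : 0 <= u -> 0 < (1 + c * u) ^+ #|N x|.
  by move=> u0; rewrite exprn_gt0 // ltr_pwDl // mulr_ge0.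
pose f x (S : {set U}) := (1 + c) ^+ #|N x :&: S| / (1 + c * b) ^+ #|N x|.
pose f' x (S : {set U}) := (1 + c) ^+ #|N x :\: S| / (1 + c * b') ^+ #|N x|.
have f0 x S : 0 <= f x S.
  by apply: divr_ge0; [apply: exprn_ge0; rewrite addr_ge0|rewrite ltW ?pos].
have f0' x S : 0 <= f' x S.
  by apply: divr_ge0; [apply: exprn_ge0; rewrite addr_ge0|rewrite ltW ?pos].
pose D (S : {set U}) := (S \subset W) && (#|S| == s).
have total : \sum_(S | D S) \sum_(x in X) (f x S + f' x S) <=
    'C(#|W|, s)%:R * (2 * #|X|%:R).
  rewrite exchange_big /= mulrA -mulr_natr -sumr_const big_distrr /=.
  apply: ler_sum => x Xx; rewrite mulr1 big_split /= mulr_natr mulr2n.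
  apply: lerD; rewrite -mulr_suml ler_pdivrMr ?pos // mul1r.
    exact: first_moment (sN x Xx) sW c0.
  exact: first_momentC (sN x Xx) sW c0.
have [S /andP[SW /eqP cS] leS] :
    exists2 S, D S & \sum_(x in X) (f x S + f' x S) <= 2 * #|X|%:R.
  have [/exists_inP//|] := boolP [exists (S | D S),
      \sum_(x in X) (f x S + f' x S) <= 2 * #|X|%:R].
  rewrite negb_exists_in => /forall_inP H; move: total; rewrite leNgt => /negP[].
  have cD : #|[set S | D S]| = 'C(#|W|, s) by rewrite cards_draws.
  rewrite -cD mulr_natl -sumr_const (eq_bigl D) => [|S]; last by rewrite inE.
  apply: ltr_sum => [|S DS]; last by rewrite ltNge H.
  have /card_gt0P[S] : (0 < #|[set S | D S]|)%N by rewrite cD bin_gt0.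
  by rewrite inE => DS; apply/hasP; exists S; rewrite ?mem_index_enum.
exists S; split=> // x Xx.
have le_x : f x S + f' x S <= 2 * #|X|%:R.
  apply: le_trans leS; rewrite (bigD1 x) //= lerDl sumr_ge0 // => y _.
  by rewrite addr_ge0.
have le1 : (1 + c) ^+ #|N x :&: S| <= 2 * #|X|%:R * (1 + c * b) ^+ #|N x|.
  by rewrite -ler_pdivrMr ?pos //; apply: le_trans le_x; rewrite lerDl.
have le2 : (1 + c) ^+ #|N x :\: S| <= 2 * #|X|%:R * (1 + c * b') ^+ #|N x|.
  by rewrite -ler_pdivrMr ?pos //; apply: le_trans le_x; rewrite lerDr.
have [W0|W0] := posnP #|W|.
  have N0 : #|N x| = 0%N.
    by apply/eqP; rewrite -leqn0 -W0 subset_leq_card // sN.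
  by rewrite N0 W0 !mulr0 subrr normr0.
have w0 : 0 < w by rewrite ltr0n.
have bb : b' = 1 - b by rewrite /b' /b natrB // mulrBl divff ?gt_eqF.
have b1 : b <= 1 by rewrite ler_pdivrMr // mul1r ler_nat.
have e01 : 0 < eps <= 1 by rewrite e0.
have t1 : #|N x :&: S|%:R <= (b + eps) * #|N x|%:R.
  by apply: chernoff_tail (big x Xx) le1; rewrite ?b0.
have t2 : #|N x :\: S|%:R <= (b' + eps) * #|N x|%:R.
  by apply: chernoff_tail (big x Xx) le2; rewrite ?b0' // bb lerBlDr lerDl.
have cN : #|N x :\: S|%:R = #|N x|%:R - #|N x :&: S|%:R :> R.
  by rewrite -(cardsID S (N x)) natrD addrC addKr.
rewrite cN bb in t2; have -> : s%:R = b * w by rewrite divfK // gt_eqF.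
rewrite -/w; set a : R := #|N x :&: S|%:R in t1 t2 *; set d : R := #|N x|%:R in t1 t2 *.
have -> : a * w - b * w * d = (a - b * d) * w by ring.
have -> : eps * w * d = eps * d * w by ring.
by rewrite normrM (gtr0_norm w0) ler_pM2r // ler_norml; apply/andP; split; lra.
Qed.

Lemma balanced_exists (V : finType) (k l s : nat) (eps : R) :
  (s <= 'C(#|V|, l))%N -> 0 < eps <= 1 ->
  (forall x : {set V}, (#|x| + k == l)%N || (#|x| == l + k)%N ->
     2 * 2 ^+ #|V| <
     expR (eps ^+ 2 * #|[set y in lev V l | (x \subset y) || (y \subset x)]|%:R / 8)) ->
  exists S : {set {set V}},
    [/\ S \subset lev V l, #|S| = s & balanced k (eps * 'C(#|V|, l)%:R) S l].
Proof.
move=> sl e01 big.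
pose X := [set x : {set V} | (#|x| + k == l)%N || (#|x| == l + k)%N].
pose N (x : {set V}) := [set y in lev V l | (x \subset y) || (y \subset x)].
have [||||S [SW cS bal]] := @low_discrepancy _ _ X N (lev V l) s eps.
- by rewrite card_lev.
- by move=> x _; apply/subsetP=> y; rewrite inE => /andP[].
- by [].
- move=> x; rewrite inE => /big; apply: le_lt_trans.
  by rewrite ler_pM2l // -natrX ler_nat (leq_trans (max_card _)) //
    -cardsT -powersetT card_powerset cardsT.
exists S; split=> // x xX; rewrite -card_lev cS.
have -> : [set y in S | (x \subset y) || (y \subset x)] = N x :&: S.
  apply/setP=> y; rewrite !inE; have [Sy|] := boolP (y \in S); rewrite ?andbF //.
  by have := subsetP SW _ Sy; rewrite inE => ->; rewrite andbT.
by apply: bal; rewrite inE.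
Qed.

End Discrepancy.

(** * Bounds on binomial coefficients, squared to stay in [nat] *)

Section BinomialBounds.
Implicit Types n i j l t : nat.

Lemma bin_leS n i : i.*2 < n -> 'C(n, i) <= 'C(n, i.+1).
Proof.
move=> lt; rewrite -(leq_pmul2l (ltn0Sn i)) mul_bin_left leq_mul2r.
by apply/orP; right; lia.
Qed.

Lemma bin_le_half n i h : i <= h -> h.*2 <= n.+1 -> 'C(n, i) <= 'C(n, h).
Proof.
elim: h => [|h IH] ih hn; first by move: ih; rewrite leqn0 => /eqP->.
move: ih; rewrite leq_eqVlt => /orP[/eqP->//|ih].
by apply: leq_trans (IH ih _) (bin_leS _); lia.
Qed.

(** Induction by the ratio [2 (2j + 1) / (j + 1)] of consecutive central coefficients; the step
    reduces to [(2j + 1) (2j + 3) <= 4 (j + 1) ^ 2]. *)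
Lemma bin_central_sq j : 'C(j.*2, j) ^ 2 * j.*2.+1 <= 4 ^ j.*2.
Proof.
elim: j => [|j IH]; first by rewrite bin0.
have E : j.+1 * 'C(j.+1.*2, j.+1) = 2 * j.*2.+1 * 'C(j.*2, j).
  rewrite doubleS binS -['C(j.*2.+1, j)]bin_sub; last by lia.
  have -> : j.*2.+1 - j = j.+1 by lia.
  by rewrite addnn -mul2n mulnCA -mul_bin_diag mulnA.
have j0 : 0 < j.+1 ^ 2 by rewrite expn_gt0.
rewrite -(leq_pmul2l j0) mulnA -expnMn E.
set c := 'C(_, _) in IH *; rewrite doubleS !expnS in IH *.
set q := 4 ^ _ in IH *; rewrite !expn0 !muln1 in IH *.
have -> : 2 * j.*2.+1 * c * (2 * j.*2.+1 * c) * j.*2.+3 =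
  4 * j.*2.+1 * j.*2.+3 * (c * c * j.*2.+1) by ring.
apply: leq_trans (_ : 4 * j.*2.+1 * j.*2.+3 * q <= _).
  by rewrite leq_mul2l IH orbT.
have -> : j.+1 * j.+1 * (4 * (4 * q)) = 16 * j.+1 * j.+1 * q by ring.
by rewrite leq_mul2r; apply/orP; right; nia.
Qed.

Lemma bin_sq_le n i : 'C(n, i) ^ 2 * n.+1 <= 4 ^ n.
Proof.
wlog le : i / i.*2 <= n.
  move=> H; have [/H//|lt] := leqP i.*2 n.
  have [ni|ni] := leqP i n; last by rewrite bin_small.
  by rewrite -bin_sub //; apply: H; lia.
have [j [E|E]] : exists j, n = j.*2 \/ n = j.*2.+1.
  by exists n./2; have := odd_double_half n; case: (odd n) => /= <-; [right|left]; lia.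
  have := bin_central_sq j; rewrite -E; apply: leq_trans.
  by rewrite leq_mul2r leq_sqr bin_le_half ?orbT //; lia.
have := bin_central_sq j.+1; rewrite doubleS binS -['C(j.*2.+1, j)]bin_sub; last by lia.
have -> : j.*2.+1 - j = j.+1 by lia.
rewrite addnn -mul2n expnMn -E [4 ^ _]expnS -[2 ^ 2]/4 -mulnA leq_pmul2l //; apply: leq_trans.
rewrite leq_mul // leq_sqr bin_le_half //; lia.
Qed.

(** The ratio of the two coefficients is [(n - j) / (j + 1)], at least
    [(n / 2) / (2 sqrt n) = sqrt n / 4]. *)
Lemma bin_tail_step n j : 0 < n -> j.+1 ^ 2 <= 4 * n -> j.*2 <= n ->
  'C(n, j) ^ 2 * n <= 16 * 'C(n, j.+1) ^ 2.
Proof.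
move=> n0 le1 le2; rewrite -(leq_pmul2l n0).
have := mul_bin_left n j; set a := 'C(n, j); set b := 'C(n, j.+1) => E.
have sqE : (j.+1 * b) ^ 2 = ((n - j) * a) ^ 2 by rewrite E.
rewrite !expnMn in sqE.
apply: leq_trans (_ : 4 * ((n - j) ^ 2 * a ^ 2) <= _).
  have : n * n <= 4 * (n - j) ^ 2 by rewrite expnS expn1; nia.
  move=> h; have -> : n * (a ^ 2 * n) = n * n * a ^ 2 by ring.
  by rewrite mulnA leq_mul2r h orbT.
rewrite -sqE mulnA [leqRHS](_ : _ = 4 * (4 * n) * b ^ 2); last by ring.
by rewrite leq_mul2r leq_mul2l le1 !orbT.
Qed.

(** Climbing [t] levels multiplies the squared coefficient by at least [(n / 16) ^ t >= n ^ 8], and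
    the squared coefficient reached is still at most [4 ^ n]. *)
Lemma bin_tail n l t : 0 < n -> 16 ^ t * n ^ 8 <= n ^ t -> (l + t) ^ 2 <= 4 * n ->
  (l + t).*2 <= n -> 'C(n, l) * n ^ 4 <= 2 ^ n.
Proof.
move=> n0 nt lt1 lt2.
have steps u : u <= t -> 'C(n, l) ^ 2 * n ^ u <= 16 ^ u * 'C(n, l + u) ^ 2.
  elim: u => [|u IH] ut; first by rewrite addn0 !expn0 muln1 mul1n.
  have /IH {}IH : u <= t by lia.
  have lu : (l + u).+1 ^ 2 <= 4 * n by apply: leq_trans lt1; rewrite leq_sqr; lia.
  have lu2 : (l + u).*2 <= n by lia.
  have := bin_tail_step n0 lu lu2; rewrite addnS => st.
  rewrite [n ^ u.+1]expnSr [16 ^ u.+1]expnSr mulnA.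
  apply: leq_trans (_ : 16 ^ u * 'C(n, l + u) ^ 2 * n <= _).
    by rewrite leq_mul2r IH orbT.
  by rewrite -[leqLHS]mulnA -[leqRHS]mulnA leq_mul2l st orbT.
have p0 : 0 < 16 ^ t by rewrite expn_gt0.
rewrite -leq_sqr expnMn -expnM -(leq_pmul2l p0) mulnCA.
apply: leq_trans (_ : 'C(n, l) ^ 2 * n ^ t <= _); first by rewrite leq_mul2l nt orbT.
apply: leq_trans (steps t (leqnn t)) _; rewrite leq_mul2l -expnM mulnC expnM.
apply/orP; right; apply: leq_trans (bin_sq_le n (l + t)).
by rewrite leq_pmulr.
Qed.

Lemma expn_le_bin a k : a ^ k <= 'C(a + k, k) * k`!.
Proof.
rewrite bin_ffact; elim: k => [|k IH]; first by rewrite ffactn0.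
by rewrite addnS ffactnS expnS /= leq_mul // leqW // leq_addr.
Qed.

End BinomialBounds.

(** * Cuts of the cube with a balanced split level *)

Section Cuts.
Variables (R : realType) (V : finType).
Local Notation n := #|V|.
Implicit Types (x y : {set V}) (S F : {set {set V}}) (b k l p s t : nat).

Lemma card_cube : #|{set V}| = 2 ^ n.
Proof. by rewrite -[#|{set V}|]cardsT -powersetT card_powerset cardsT. Qed.

Lemma subset_card_exists (U : finType) (W : {set U}) s : s <= #|W| ->
  exists2 S : {set U}, S \subset W & #|S| = s.
Proof.
rewrite -bin_gt0 -cards_draws => /card_gt0P[S]; rewrite inE => /andP[sS /eqP cS].
by exists S.
Qed.

Lemma balanced_le k (eta eta' : R) S l : (eta <= eta')%R ->
  balanced k eta S l -> balanced k eta' S l.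
Proof.
by move=> le bal x /bal/le_trans; apply; rewrite ler_wpM2r ?ler0n.
Qed.

(** Both products lie between [0] and ['C(n, l) * #|N|], so an error of a whole level covers any
    difference. *)
Lemma balanced_trivial k S l : S \subset lev V l ->
  balanced k ('C(n, l)%:R : R) S l.
Proof.
move=> sS x _; set M := [set y in S | _]; set N := [set y in lev V l | _].
have MN : #|M| <= #|N|.
  apply/subset_leq_card/subsetP=> y; rewrite !inE => /andP[/(subsetP sS)].
  by rewrite inE => -> ->.
have Sw : #|S| <= 'C(n, l) by rewrite -card_lev subset_leq_card.
rewrite -!natrM ler_norml; apply/andP; split.
  rewrite lerNl opprB lerBlDr -natrD ler_nat; apply: leq_trans (leq_addr _ _).
  by rewrite leq_mul2r Sw orbT.
rewrite lerBlDr -natrD ler_nat mulnC; apply: leq_trans (leq_addr _ _).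
by rewrite leq_mul2l MN orbT.
Qed.

(* Satisfied by [t = 10] for all large [N]. *)
Definition large_for t (N : nat) :=
  [/\ 16 <= N, t ^ 2 <= N, 16 ^ t * N ^ 8 <= N ^ t & 16 * N ^ 9 * (2 * t)`! <= N ^ t].

Definition slack : R := (2 ^+ n / n%:R ^+ 4)%R.

Lemma slack_ge0 : (0 <= slack)%R.
Proof. by rewrite divr_ge0 ?exprn_ge0 ?ler0n. Qed.

Lemma balanced_level t l s : large_for t n -> l <= n -> s <= 'C(n, l) ->
  exists S : {set {set V}},
    [/\ S \subset lev V l, #|S| = s & balanced (2 * t) slack S l].
Proof.
move=> [n16 nt tail mid] ln sl.
have n0 : 0 < n by apply: leq_trans n16.
have n40 : (0 < n%:R ^+ 4 :> R)%R by rewrite exprn_gt0 ?ltr0n.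
have tailE j : j ^ 2 <= n -> 'C(n, j) * n ^ 4 <= 2 ^ n.
  move=> jn; have jt : (j + t) ^ 2 <= 4 * n by rewrite !expnS !expn0 in jn nt *; nia.
  by apply: (bin_tail n0 tail jt); rewrite !expnS !expn0 in jt; nia.
(* Within [sqrt n] of either end a whole level is no larger than [slack], so any [S] of the right
   size is balanced. *)
have [tl|] := boolP ((l ^ 2 <= n) || ((n - l) ^ 2 <= n)).
  have [|S sS cS] := @subset_card_exists _ (lev V l) s; first by rewrite card_lev.
  exists S; split=> //; apply: (@balanced_le _ 'C(n, l)%:R%R); last exact: balanced_trivial.
  rewrite ler_pdivlMr // -!natrX -natrM ler_nat.
  by case/orP: tl => /tailE //; rewrite bin_sub.
rewrite negb_or -!ltnNge => /andP[ml mr].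
have e0 : (0 < (n%:R ^+ 4)^-1 :> R)%R by rewrite invr_gt0.
have [|x xl|S [sS cS bal]] := @balanced_exists R V (2 * t) l s (n%:R ^+ 4)^-1%R sl.
- rewrite e0 invf_le1 // exprn_ege1 // ler1n; exact: n0.
- set d := #|[set y in _ | _]|.
  (* For [x] below level [l] the comparable vertices are supersets and [a = n - l]; for [x] above
     they are subsets and [a = l]. *)
  have [a [adn an]] : exists a, d = 'C(a + 2 * t, 2 * t) /\ n < a ^ 2.
    case/orP: xl => /eqP xl.
      exists (n - l); split=> //.
      rewrite (_ : n - l + 2 * t = n - #|x|); last by lia.
      rewrite (_ : 2 * t = l - #|x|) ?card_lev_super; last by lia.
      rewrite -card_lev_super; last by apply/andP; split; lia.
      apply: eq_card => y; rewrite !inE; case: eqP => //= yl.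
      by rewrite cmp_sub // yl; lia.
    exists l; split=> //.
    rewrite -bin_sub ?leq_addl // addnK -xl -card_lev_sub.
    apply: eq_card => y; rewrite !inE; case: eqP => //= yl.
    by rewrite orbC cmp_sub // yl; lia.
  have dbig : 16 * n ^ 9 <= d.
    have f0 := fact_gt0 (2 * t); rewrite -(leq_pmul2r f0).
    apply: leq_trans mid _; rewrite adn; apply: leq_trans (expn_le_bin _ _).
    by rewrite expnM; case: (t) => // u; rewrite leq_exp2r // ltnW.
  (* With [eps = n ^ -4] and [d >= 16 n ^ 9] the exponent [eps ^+ 2 * d / 8] is at least [2 n],
     which beats [2 * 2 ^ n]. *)
  apply: lt_le_trans (_ : (expR 1 ^+ (2 * n) <= _)%R).
    apply: lt_le_trans (_ : ((2 ^+ (2 * n) : R) <= _)%R).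
      by rewrite -exprS -!natrX ltr_nat ltn_exp2l //; lia.
    rewrite lerXn2r ?nnegrE ?expR_ge0 //.
    by apply: le_trans (expR_ge1Dx 1); lra.
  rewrite -expRM_natr mul1r ler_expR.
  have : ((16 * n ^ 9)%N%:R <= d%:R :> R)%R by rewrite ler_nat.
  rewrite natrM natrX natrM; set q : R := (n%:R)%R => dle.
  have q0 : (0 < q)%R by rewrite ltr0n.
  rewrite ler_pdivlMr // exprVn ler_pdivlMl ?exprn_gt0 //.
  by apply: le_trans dle; rewrite le_eqVlt; apply/orP; left; apply/eqP; ring.
exists S; split=> //; apply: (@balanced_le _ _ _ _ _ _ bal).
rewrite /slack mulrC; apply: ler_wpM2r; first exact: ltW.
rewrite -natrX ler_nat -card_cube -card_lev.
exact: max_card.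
Qed.

Definition cut k (eta : R) p b F :=
  [/\ #|F| = p, b <= n, (forall x, #|x| < b -> x \in F),
      {in F, forall x, #|x| <= b} & balanced k eta (F :&: lev V b) b].

Lemma cut_exists t p : large_for t n -> p <= 2 ^ n ->
  exists b F, cut (2 * t) slack p b F.
Proof.
move=> big pn; pose below b := [set x : {set V} | #|x| < b].
have exb : exists b, p <= #|below b.+1|.
  exists n; rewrite (_ : below _ = setT) ?cardsT ?card_cube //.
  by apply/setP=> x; rewrite !inE ltnS max_card.
(* By minimality at most [p] vertices lie strictly below level [b], and a part of level [b] supplies
   the rest. *)
case: (ex_minnP exb) => b pb minb.
have bn : b <= n.
  apply: minb; rewrite (_ : below _ = setT) ?cardsT ?card_cube //.
  by apply/setP=> x; rewrite !inE ltnS max_card.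
have cb : #|below b.+1| = #|below b| + #|lev V b|.
  rewrite -cardsUI (_ : _ :&: _ = set0) ?cards0 ?addn0; last first.
    by apply/setP=> x; rewrite !inE; lia.
  by apply: eq_card => x; rewrite !inE; lia.
have bp : #|below b| <= p.
  case: (b) minb => [|c] minb; last by rewrite leqNgt; apply/negP=> /ltnW/minb; lia.
  by rewrite (_ : below 0 = set0) ?cards0 //; apply/setP=> x; rewrite !inE.
have [|S [sS cS bal]] := @balanced_level t b (p - #|below b|) big bn.
  by rewrite -card_lev; lia.
have dis : below b :&: S = set0.
  apply/setP=> x; rewrite !inE; apply/negP=> /andP[xb /(subsetP sS)].
  by rewrite inE => /eqP xE; rewrite xE ltnn in xb.
exists b, (below b :|: S); split=> //.
- by rewrite cardsU dis cards0 subn0 cS subnKC.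
- by move=> x xb; rewrite !inE xb.
- move=> x; rewrite !inE => /orP[/ltnW//|/(subsetP sS)].
  by rewrite inE => /eqP->.
rewrite (_ : _ :&: _ = S) //; apply/setP=> x; rewrite !inE.
have [Sx|Sx] := boolP (x \in S); last by rewrite orbF; lia.
by have := subsetP sS _ Sx; rewrite inE orbT => ->.
Qed.

End Cuts.

(** * Hall's inequality for two consecutive slabs *)

Section CutInequality.
Variables (R : realType) (V : finType).
Local Notation n := #|V|.
Local Notation dens := (@dens R V).
Implicit Types (x y : {set V}) (A I S F : {set {set V}}) (b k l p q : nat).

Lemma card_by_level A : #|A| = \sum_(j < n.+1) #|A :&: lev V j|.
Proof.
rewrite -sum1_card (partition_big (fun x : {set V} => inord #|x| : 'I_n.+1) predT) //=.
apply: eq_bigr => j _; rewrite -[RHS]sum1_card; apply: eq_bigl => x; rewrite !inE.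
by rewrite -val_eqE /= inordK // ltnS max_card.
Qed.

(** The error sits on the single level [b], so summation over all levels pays it once. *)
Lemma levelwise_upper A I b (z e : R) : (0 <= e)%R ->
  (forall j, j <= n ->
     (#|(A :&: lev V j) :&: I|%:R <= z * #|A :&: lev V j|%:R + (j == b)%:R * e)%R) ->
  (#|A :&: I|%:R <= z * #|A|%:R + e)%R.
Proof.
move=> e0 H; rewrite (card_by_level (A :&: I)) (card_by_level A) !natr_sum mulr_sumr.
apply: (@le_trans _ _ (\sum_(j < n.+1)
    (z * #|A :&: lev V j|%:R + (j == b :> nat)%:R * e))%R).
  by apply: ler_sum => j _; rewrite setIAC H // -ltnS.
rewrite big_split /= lerD2l -mulr_suml -[leRHS]mul1r ler_wpM2r //.
rewrite -natr_sum lern1.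
have [bn|bn] := ltnP b n.+1; last first.
  by rewrite big1 // => j _; case: eqP => // jb; have := ltn_ord j; rewrite jb ltnNge bn.
rewrite (bigD1 (Ordinal bn)) //= eqxx big1 // => j; rewrite -val_eqE /=.
by move/negPf->.
Qed.

Lemma levelwise_lower A I b (z e : R) : (0 <= e)%R ->
  (forall j, j <= n ->
     (z * #|A :&: lev V j|%:R - (j == b)%:R * e <= #|(A :&: lev V j) :&: I|%:R)%R) ->
  (z * #|A|%:R - e <= #|A :&: I|%:R)%R.
Proof.
have card_setIC (D : {set {set V}}) : (#|D :&: ~: I|%:R = #|D|%:R - #|D :&: I|%:R :> R)%R.
  by rewrite -(cardsID I D) natrD addrC addKr setDE.
move=> e0 H; have := @levelwise_upper A (~: I) b (1 - z)%R e e0.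
rewrite card_setIC => U; suff: (#|A|%:R - #|A :&: I|%:R <= (1 - z) * #|A|%:R + e)%R by lra.
by apply: U => j jn; have := H j jn; rewrite card_setIC; lra.
Qed.

Lemma card_window b u (w : nat) : (forall l, 'C(n, l) <= w) ->
  #|[set x : {set V} | b <= #|x| < b + u]| <= u * w.
Proof.
move=> lew; elim: u => [|u IH].
  by rewrite leqn0 cards_eq0; apply/eqP/setP=> x; rewrite !inE; lia.
rewrite mulSnr; apply: leq_trans (leq_add IH (lew (b + u))).
rewrite -card_lev; apply: leq_trans (leq_card_setU _ _); apply: subset_leq_card.
by apply/subsetP=> x; rewrite !inE; lia.
Qed.

Lemma cut_sub k (eta : R) p p' b b' F F' :
  cut k eta p b F -> cut k eta p' b' F' -> b < b' -> F \subset F'.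
Proof.
move=> [_ _ _ leF _] [_ _ ltF' _ _] bb; apply/subsetP=> x /leF xb.
by apply: ltF'; apply: leq_ltn_trans bb.
Qed.

(** If [b' <= b + q], then [F' :\: F] would fit into the [q.+1] levels from [b] to [b + q]. *)
Lemma cut_gap k (eta : R) p b b' F F' N q w :
  cut k eta p b F -> cut k eta (p + N) b' F' -> (forall l, 'C(n, l) <= w) ->
  q.+1 * w < N -> b + q < b'.
Proof.
move=> [cF _ ltF _ _] [cF' _ _ leF' _] lew qN; rewrite ltnNge; apply/negP=> bb.
suff: #|F'| <= #|F| + q.+1 * w by rewrite cF cF'; lia.
apply: leq_trans (leq_add (leqnn _) (card_window b q.+1 lew)).
apply: leq_trans (leq_card_setU _ _); apply: subset_leq_card.
apply/subsetP=> x xF'; rewrite !inE; have [xb|/ltF->//] := leqP b #|x|.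
by have := leF' _ xF'; lia.
Qed.

(** Both errors of [cut_hall] must be paid from [dens I h - dens I g]. At the upper end, growth is
    applied one level below [h], and replacing [z (1 - z)] by [z' (1 - z')] costs at most [z' - z],
    hence the extra [1]. *)
Lemma dens_growth_both I g h : upset I -> g < h <= n ->
  (dens I g * (1 - dens I g) <= n%:R ^+ 2 * (dens I h - dens I g) /\
   dens I h * (1 - dens I h) <= (n%:R ^+ 2 + 1) * (dens I h - dens I g))%R.
Proof.
move=> upI /andP[gh hn]; have n0 : (0 <= n%:R ^+ 2 :> R)%R by rewrite exprn_ge0 ?ler0n.
split.
  apply: le_trans (dens_growth R upI (leq_trans gh hn)) _.
  by rewrite ler_wpM2l // lerB // dens_mono // gh.
case: h gh hn => // h gh hn; have := dens_growth R upI hn.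
have le1 : (dens I g <= dens I h)%R by rewrite dens_mono //; apply/andP; split; lia.
have le2 : (dens I h <= dens I h.+1)%R by rewrite dens_mono // leqnSn.
have := dens_ge0 R I h.
move: (dens I g) (dens I h) (dens I h.+1) le1 le2 => y z z' yz zz' z0 G.
move: (n%:R ^+ 2)%R n0 G => N N0 G.
have h1 : (z' * (1 - z') <= z * (1 - z) + (z' - z))%R by nra.
have h2 : (0 <= (N + 1) * (z - y))%R by rewrite mulr_ge0 ?subr_ge0 // addr_ge0.
lra.
Qed.

(** * Pieces of one slab against a reference density *)

Section Slab.
Variables (k : nat) (eta : R) (p p' b b' : nat) (F F' I : {set {set V}}).
Hypotheses (eta0 : (0 <= eta)%R) (upI : upset I) (bb' : b < b').
Hypotheses (cF : cut k eta p b F) (cF' : cut k eta p' b' F').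

Let err (h : nat) : R := (2 * dens I h * (1 - dens I h) * eta)%R.

Lemma err_ge0 h : (0 <= err h)%R.
Proof.
have := dens_ge0 R I h; have : (0 <= 1 - dens I h)%R by rewrite subr_ge0 dens_le1.
by rewrite /err; move: (dens I h) => z z1 z0; rewrite !mulr_ge0.
Qed.

Lemma errb_ge0 (c : bool) h : (0 <= c%:R * err h)%R.
Proof. by rewrite mulr_ge0 ?ler0n ?err_ge0. Qed.

Lemma slab_lev_out j : (j < b) || (b' < j) -> (F' :\: F) :&: lev V j = set0.
Proof.
move=> jb; apply/setP=> x; rewrite !inE; apply/negP=> /andP[/andP[nF F'x] /eqP xj].
case: cF cF' => [_ _ ltF _ _] [_ _ _ leF' _]; case/orP: jb => [jb|b'j].
  by case/negP: nF; rewrite ltF ?xj.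
by have := leF' _ F'x; rewrite xj leqNgt b'j.
Qed.

Lemma slab_lev_mid j : b < j < b' -> (F' :\: F) :&: lev V j = lev V j.
Proof.
move=> /andP[bj jb']; apply/setIidPr/subsetP=> x; rewrite !inE => /eqP xj.
case: cF cF' => [_ _ _ leF _] [_ _ ltF' _ _]; rewrite ltF' ?xj // andbT.
by apply/negP=> /leF; rewrite xj leqNgt bj.
Qed.

Lemma slab_lev_bot : (F' :\: F) :&: lev V b = lev V b :\: (F :&: lev V b).
Proof.
case: cF' => [_ _ ltF' _ _]; apply/setP=> x; rewrite !inE.
by have [xb|xb] := eqVneq #|x| b; rewrite ?andbF ?andbT // ltF' ?xb ?andbT.
Qed.

Lemma slab_lev_top : (F' :\: F) :&: lev V b' = F' :&: lev V b'.
Proof.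
case: cF => [_ _ _ leF _]; apply/setP=> x; rewrite !inE.
have [xb|xb] := eqVneq #|x| b'; rewrite ?andbF ?andbT //.
have [/leF|//] := boolP (x \in F); by rewrite xb leqNgt bb'.
Qed.

Lemma lev_mid_upper j h : j <= h <= n ->
  (#|lev V j :&: I|%:R <= dens I h * #|lev V j|%:R)%R.
Proof.
move=> /andP[jh hn]; have jn := leq_trans jh hn.
rewrite setIC -(dens_bin R I jn) card_lev ler_wpM2r ?ler0n // dens_mono //.
by rewrite jh.
Qed.

Lemma lev_mid_lower j h : h <= j <= n ->
  (dens I h * #|lev V j|%:R <= #|lev V j :&: I|%:R)%R.
Proof.
move=> hjn; have [hj jn] := andP hjn.
by rewrite setIC -(dens_bin R I jn) card_lev ler_wpM2r ?ler0n // dens_mono.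
Qed.

Lemma below_lev (A : {set {set V}}) c j :
  A :&: [set x : {set V} | #|x| < c] :&: lev V j = if j < c then A :&: lev V j else set0.
Proof.
apply/setP=> x; case: ifP => jc; rewrite !inE -andbA;
  by case: (eqVneq #|x| j) => [->|]; rewrite ?andbF ?andbT // jc ?andbF ?andbT.
Qed.

Lemma above_lev (A : {set {set V}}) c j :
  (A :\: [set x : {set V} | #|x| < c]) :&: lev V j = if j < c then set0 else A :&: lev V j.
Proof.
apply/setP=> x; case: ifP => jc; rewrite !inE -andbA;
  by case: (eqVneq #|x| j) => [->|]; rewrite ?andbF ?andbT // jc ?andbF ?andbT.
Qed.

(** This and the next three lemmas divide a slab at weight [c] so that each piece contains at most
    one split level, [b] or [b']. The reference level [h] lies on one side of all levels of the
    piece and at distance at least [k] from the split one: full levels are compared exactly, the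
    split one costs [err h]. *)
Lemma slab_below_upper c h : b + k <= h -> c <= h.+1 -> c <= b' -> h <= n ->
  let A := (F' :\: F) :&: [set x : {set V} | #|x| < c] in
  (#|A :&: I|%:R <= dens I h * #|A|%:R + err h)%R.
Proof.
move=> bh ch cb' hn /=; apply: (@levelwise_upper _ _ b) => [|j jn]; first exact: err_ge0.
have zero : (#|set0 :&: I|%:R <=
    dens I h * #|(set0 : {set {set V}})|%:R + (j == b)%:R * err h)%R.
  by rewrite set0I cards0 mulr0 add0r errb_ge0.
rewrite below_lev; case: ifP => // jc; have [jb|bj|jb] := ltngtP j b.
- by rewrite slab_lev_out ?jb //; move: zero; rewrite (ltn_eqF jb).
- rewrite slab_lev_mid ?bj ?(leq_trans jc) // mul0r addr0 lev_mid_upper // hn andbT.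
  by rewrite -ltnS (leq_trans jc).
rewrite jb slab_lev_bot mul1r; apply: (@balanced_upper _ _ k) => //.
- exact: subsetDl.
- by case: cF => _ _ _ _ bal; apply: balancedD; rewrite ?subsetIr.
by rewrite bh.
Qed.

Lemma slab_above_upper c h : b < c -> b' + k <= h -> h <= n ->
  let A := (F' :\: F) :\: [set x : {set V} | #|x| < c] in
  (#|A :&: I|%:R <= dens I h * #|A|%:R + err h)%R.
Proof.
move=> bc bh hn /=; apply: (@levelwise_upper _ _ b') => [|j jn]; first exact: err_ge0.
have zero : (#|set0 :&: I|%:R <=
    dens I h * #|(set0 : {set {set V}})|%:R + (j == b')%:R * err h)%R.
  by rewrite set0I cards0 mulr0 add0r errb_ge0.
rewrite above_lev; case: ifP => // /negbT; rewrite -leqNgt => cj.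
have [jb|bj|jb] := ltngtP j b'.
- rewrite slab_lev_mid ?jb ?(leq_trans bc) // mul0r addr0 lev_mid_upper // hn andbT.
  by rewrite (leq_trans (ltnW jb)) // (leq_trans _ bh) ?leq_addr.
- by rewrite slab_lev_out ?bj ?orbT //; move: zero; rewrite (gtn_eqF bj).
rewrite jb slab_lev_top mul1r; apply: (@balanced_upper _ _ k) => //.
- exact: subsetIr.
- by case: cF'.
by rewrite bh.
Qed.

Lemma slab_below_lower c h : h + k <= b -> c <= b' ->
  let A := (F' :\: F) :&: [set x : {set V} | #|x| < c] in
  (dens I h * #|A|%:R - err h <= #|A :&: I|%:R)%R.
Proof.
move=> hb cb' /=; have bn : b <= n by case: cF.
apply: (@levelwise_lower _ _ b) => [|j jn]; first exact: err_ge0.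
have zero : (dens I h * #|(set0 : {set {set V}})|%:R - (j == b)%:R * err h <=
    #|set0 :&: I|%:R)%R.
  by rewrite set0I cards0 mulr0 sub0r oppr_le0 errb_ge0.
rewrite below_lev; case: ifP => // jc; have [jb|bj|jb] := ltngtP j b.
- by rewrite slab_lev_out ?jb //; move: zero; rewrite (ltn_eqF jb).
- rewrite slab_lev_mid ?bj ?(leq_trans jc) // mul0r subr0 lev_mid_lower // jn andbT.
  by rewrite (leq_trans _ (ltnW bj)) // (leq_trans _ hb) ?leq_addr.
rewrite jb slab_lev_bot mul1r; apply: (@balanced_lower _ _ k _ _ b) => //.
- exact: subsetDl.
- by case: cF => _ _ _ _ bal; apply: balancedD; rewrite ?subsetIr.
Qed.

Lemma slab_above_lower c h : b < c -> h <= c -> h + k <= b' ->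
  let A := (F' :\: F) :\: [set x : {set V} | #|x| < c] in
  (dens I h * #|A|%:R - err h <= #|A :&: I|%:R)%R.
Proof.
move=> bc hc hb /=; have bn : b' <= n by case: cF'.
apply: (@levelwise_lower _ _ b') => [|j jn]; first exact: err_ge0.
have zero : (dens I h * #|(set0 : {set {set V}})|%:R - (j == b')%:R * err h <=
    #|set0 :&: I|%:R)%R.
  by rewrite set0I cards0 mulr0 sub0r oppr_le0 errb_ge0.
rewrite above_lev; case: ifP => // /negbT; rewrite -leqNgt => cj.
have [jb|bj|jb] := ltngtP j b'.
- rewrite slab_lev_mid ?jb ?(leq_trans bc) // mul0r subr0 lev_mid_lower // jn andbT.
  exact: leq_trans cj.
- by rewrite slab_lev_out ?bj ?orbT //; move: zero; rewrite (gtn_eqF bj).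
rewrite jb slab_lev_top mul1r; apply: (@balanced_lower _ _ k _ _ b') => //.
- exact: subsetIr.
- by case: cF'.
Qed.

End Slab.

(** The reference levels are [g = b1 - k] and [h = b1 + k]. In [P] the density is at most [zg] up to
    level [g] and at most [zh] in the [k] levels above; in [Q] it is at least [zg] below level [h]
    and at least [zh] from there on. The two windows around [b1] hold at most [N / 2] vertices
    together, so a gain of [(zh - zg) * N / 2] remains to pay for the split levels. *)
Lemma cut_hall k (eta : R) p b0 b1 b2 F0 F1 F2 N w I :
  0 < k -> (0 <= eta)%R -> (forall l, 'C(n, l) <= w) -> 0 < w -> 8 * k * w <= N ->
  (8 * (2 * n%:R ^+ 2 + 1) * eta <= N%:R)%R ->
  cut k eta p b0 F0 -> cut k eta (p + N) b1 F1 -> cut k eta (p + N + N) b2 F2 ->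
  upset I -> #|(F1 :\: F0) :&: I| <= #|(F2 :\: F1) :&: I|.
Proof.
move=> k0 eta0 lew w0 kw slk c0 c1 c2 upI.
have wN : (2 * k).+1 * w < N by nia.
have kwN a c : a <= k * w -> c <= k * w -> (a + c).*2 <= N by nia.
(* Gaps above [2 * k] put [g] at distance at least [k] from [b0], and [h] from [b2]. *)
have gap01 := cut_gap c0 c1 lew wN; have gap12 := cut_gap c1 c2 lew wN.
have sub01 : F0 \subset F1 by apply: cut_sub c0 c1 _; lia.
have sub12 : F1 \subset F2 by apply: cut_sub c1 c2 _; lia.
have cF0 : #|F0| = p by case: c0.
have [cF1 b1n lt1 le1 _] := c1; have [cF2 b2n _ _ _] := c2.
set P := F1 :\: F0; set Q := F2 :\: F1.
have cP : #|P| = N by rewrite cardsD (setIidPr sub01) cF0 cF1 addKn.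
have cQ : #|Q| = N by rewrite cardsD (setIidPr sub12) cF1 cF2 addKn.
have [g gE] : exists g, b1 = g + k by exists (b1 - k); rewrite subnK //; lia.
pose h := b1 + k; set zg := dens I g; set zh := dens I h.
pose err (z : R) := (2 * z * (1 - z) * eta)%R.
have ghn : g < h <= n by apply/andP; split; lia.
have [growg growh] := dens_growth_both upI ghn.
pose low := [set x : {set V} | #|x| < g.+1]; pose lowQ := [set x : {set V} | #|x| < h].
have b01 : b0 < b1 by lia.
have b12 : b1 < b2 by lia.
have U1 : (#|(P :&: low) :&: I|%:R <= zg * #|P :&: low|%:R + err zg)%R.
  by apply: (slab_below_upper eta0 upI b01 c0 c1); clear -gap01 gap12 gE k0 b1n b2n; lia.
have U2 : (#|(P :\: low) :&: I|%:R <= zh * #|P :\: low|%:R + err zh)%R.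
  by apply: (slab_above_upper eta0 upI b01 c0 c1); clear -gap01 gap12 gE k0 b1n b2n; lia.
have L1 : (zg * #|Q :&: lowQ|%:R - err zg <= #|(Q :&: lowQ) :&: I|%:R)%R.
  by apply: (slab_below_lower eta0 upI b12 c1 c2); clear -gap01 gap12 gE k0 b1n b2n; lia.
have L2 : (zh * #|Q :\: lowQ|%:R - err zh <= #|(Q :\: lowQ) :&: I|%:R)%R.
  by apply: (slab_above_lower eta0 upI b12 c1 c2); clear -gap01 gap12 gE k0 b1n b2n; lia.
have wP : #|P :\: low| <= k * w.
  apply: leq_trans (card_window g.+1 k lew); apply: subset_leq_card.
  by apply/subsetP=> x; rewrite !inE => /and3P[xg _ /le1 xb1]; clear -xg xb1 gE; lia.
have wQ : #|Q :&: lowQ| <= k * w.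
  apply: leq_trans (card_window b1 k lew); apply: subset_leq_card.
  apply/subsetP=> x; rewrite !inE => /andP[/andP[nF _] xh].
  by rewrite xh andbT leqNgt; apply: contra nF => /lt1.
have splitI A B : (#|A :&: I|%:R = #|(A :&: B) :&: I|%:R + #|(A :\: B) :&: I|%:R :> R)%R.
  by rewrite -natrD -(cardsID B (A :&: I)) setIAC setIDAC.
rewrite -(ler_nat R) (splitI P low) (splitI Q lowQ).
have eP : (#|P :&: low|%:R = N%:R - #|P :\: low|%:R :> R)%R.
  by rewrite -cP -(cardsID low P) natrD addrK.
have eQ : (#|Q :\: lowQ|%:R = N%:R - #|Q :&: lowQ|%:R :> R)%R.
  by rewrite -cQ -(cardsID lowQ Q) natrD addrC addKr.
rewrite {}eP in U1; rewrite {}eQ in L2.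
have half : (N%:R / 2 <= N%:R - #|P :\: low|%:R - #|Q :&: lowQ|%:R :> R)%R.
  have := kwN _ _ wP wQ.
  by rewrite -(ler_nat R) -muln2 natrM natrD; lra.
move: U1 U2 L1 L2 half.
set a : R := (#|P :\: low|%:R)%R; set c : R := (#|Q :&: lowQ|%:R)%R; set NN : R := (N%:R)%R.
set u1 : R := (#|_|%:R)%R; set u2 : R := (#|_|%:R)%R.
set l1 : R := (#|_|%:R)%R; set l2 : R := (#|_|%:R)%R.
move=> U1 U2 L1 L2 half.
have D0 : (0 <= zh - zg)%R by rewrite subr_ge0 dens_mono //; case/andP: ghn => /ltnW->.
have E1 : (err zg <= 2 * (n%:R ^+ 2 * (zh - zg)) * eta)%R.
  by rewrite /err -mulrA -mulrA -[leRHS]mulrA ler_pM2l // mulrA ler_wpM2r.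
have E2 : (err zh <= 2 * ((n%:R ^+ 2 + 1) * (zh - zg)) * eta)%R.
  by rewrite /err -mulrA -mulrA -[leRHS]mulrA ler_pM2l // mulrA ler_wpM2r.
(* Each of [err zg] and [err zh] occurs twice, so by [E1] and [E2] the total loss is at most
   [4 * (2 * n ^ 2 + 1) * eta * (zh - zg)], half the left side here. *)
have M1 : ((zh - zg) * (8 * (2 * n%:R ^+ 2 + 1) * eta) <= (zh - zg) * NN)%R.
  by rewrite ler_wpM2l.
have M2 : ((zh - zg) * (NN / 2) <= (zh - zg) * (NN - a - c))%R by rewrite ler_wpM2l.
move: M1 M2 E1 E2 U1 U2 L1 L2; move: (err zg) (err zh) => eg eh; lra.
Qed.

End CutInequality.

(** * The chain of slabs and the matchings between them *)

Section Slabs.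
Variables (R : realType) (V : finType).
Local Notation n := #|V|.
Implicit Types (x y : {set V}) (P Q F : {set {set V}}).

(** For [A] inside [P] let [I] be its up-closure: [A] lies in [P :&: I], and the neighbours of [A]
    in [Q] are exactly [Q :&: I]. *)
Lemma upset_matching P Q : #|P| = #|Q| ->
  (forall I : {set {set V}}, upset I -> #|P :&: I| <= #|Q :&: I|) ->
  exists f : {set V} -> {set V},
    [/\ {in P &, injective f}, f @: P = Q & {in P, forall x, x \subset f x}].
Proof.
move=> cPQ upPQ; pose r x y := (x \subset y) && (y \in Q).
have [|f [injf rf]] := @hall _ _ set0 r P.
  move=> A sAP; pose I := [set y : {set V} | [exists x in A, x \subset y]].
  apply: leq_trans (_ : #|P :&: I| <= _).
    apply: subset_leq_card; apply/subsetP=> x Ax; rewrite !inE (subsetP sAP) //=.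
    by apply/exists_inP; exists x.
  apply: leq_trans (upPQ I _) _.
    move=> x y xy; rewrite !inE => /exists_inP[u Au ux].
    by apply/exists_inP; exists u => //; apply: subset_trans xy.
  apply: subset_leq_card; apply/subsetP=> y; rewrite !inE => /andP[Qy].
  by case/exists_inP=> x Ax xy; apply/exists_inP; exists x; rewrite // /r xy.
exists f; split=> // [|x /rf/andP[]//].
apply/eqP; rewrite eqEcard card_in_imset // cPQ leqnn andbT.
by apply/subsetP=> _ /imsetP[x /rf/andP[_ Qf] ->].
Qed.

Lemma cut_downset k (eta : R) p b F x y :
  cut k eta p b F -> x \subset y -> y \in F -> x \in F.
Proof.
move=> [_ _ ltF leF _] xy Fy; have [xlt|yx] := ltnP #|x| #|y|.
  by apply: ltF; apply: leq_trans xlt (leF _ Fy).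
by have /eqP-> : x == y by rewrite eqEcard xy.
Qed.

Lemma slabs_exist t m : 0 < t -> 0 < m -> large_for t n -> (8 * (2 * t) * m) ^ 2 <= n ->
  let N := 2 ^ n %/ m in
  exists (F : nat -> {set {set V}}) (b : nat -> nat),
  [/\ forall i, i <= m -> #|F i| = i * N,
      forall i j, i <= j <= m -> F i \subset F j,
      forall i x y, i <= m -> x \subset y -> y \in F i -> x \in F i,
      forall i x, i <= m -> (x \in F i -> #|x| <= b i) /\ (x \notin F i -> b i <= #|x|)
    & forall i, i.+1 < m -> exists f : {set V} -> {set V},
        [/\ {in F i.+1 :\: F i &, injective f},
            f @: (F i.+1 :\: F i) = F i.+2 :\: F i.+1
          & {in F i.+1 :\: F i, forall x, x \subset f x}]].
Proof.
move=> t0 m0 big kmn N; set k := 2 * t in kmn *.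
have k0 : 0 < k by rewrite muln_gt0.
(* A level has at most [2 ^ n / sqrt (n + 1)] vertices, and [kmn] makes [sqrt n] at least
   [8 * k * m]; so [8 * k] full levels fit into a slab. *)
pose w := 2 ^ n %/ (8 * k * m).
have km0 : 0 < 8 * k * m by rewrite muln_gt0 m0 andbT muln_gt0 k0.
have lew l : 'C(n, l) <= w.
  rewrite leq_divRL // -leq_sqr expnMn -[in leqRHS]expnM mulnC.
  have -> : 2 ^ (n * 2) = 4 ^ n by rewrite mulnC expnM.
  by apply: leq_trans (bin_sq_le n l); rewrite mulnC leq_mul2l leqW ?orbT.
have w0 : 0 < w by apply: leq_trans (lew 0); rewrite bin0.
have kwN : 8 * k * w <= N.
  rewrite leq_divRL // mulnAC mulnC; exact: leq_trunc_div.
have mN : m * N <= 2 ^ n by rewrite mulnC leq_trunc_div.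
have N0 : 0 < N by apply: leq_trans kwN; rewrite muln_gt0 w0 andbT muln_gt0 k0.
have slk : (8 * (2 * n%:R ^+ 2 + 1) * slack R V <= N%:R)%R.
  have pow : 2 ^ n <= 2 * m * N.
    by have := ltn_ceil (2 ^ n) m0; rewrite -/N; move: (2 ^ n) => e; nia.
  have mn : 64 * m <= n by move: kmn; rewrite expnS expn1; nia.
  have n0 : 0 < n by lia.
  have nn : 16 * m * (2 * n ^ 2 + 1) <= n ^ 4.
    rewrite (expnS n 3) leq_mul //; first by lia.
    rewrite (expnS n 2); have := sqrn_gt0 n; rewrite n0; move: (n ^ 2) (n) mn => a q mn a0.
    by nia.
  have nat_le : 8 * (2 * n ^ 2 + 1) * 2 ^ n <= N * n ^ 4.
    apply: leq_trans (_ : 8 * (2 * n ^ 2 + 1) * (2 * m * N) <= _).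
      by rewrite leq_mul2l pow orbT.
    have -> : 8 * (2 * n ^ 2 + 1) * (2 * m * N) = N * (16 * m * (2 * n ^ 2 + 1)) by ring.
    by rewrite leq_mul2l nn orbT.
  rewrite /slack mulrA ler_pdivrMr ?exprn_gt0 ?ltr0n //.
  by move: nat_le; rewrite -(ler_nat R) !natrM natrD !natrM !natrX.
have /choice[FB cutF] i : exists FB : nat * {set {set V}},
    i <= m -> cut k (slack R V) (i * N) FB.1 FB.2.
  (* Beyond [m] the pair is a dummy, so that [choice] yields a total function. *)
  have [im|im] := leqP i m; last by exists (0, set0).
  have [|b [F c]] := @cut_exists R V t (i * N) big; last by exists (b, F).
  by apply: leq_trans mN; rewrite leq_mul2r im orbT.
have wN : 1 * w < N by nia.
have gap i : i < m -> (FB i).1 < (FB i.+1).1.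
  move=> im; have c' := cutF i.+1 im; rewrite mulSnr in c'.
  by have := cut_gap (cutF i (ltnW im)) c' lew wN; rewrite addn0.
have subS i : i < m -> (FB i).2 \subset (FB i.+1).2.
  by move=> im; apply: cut_sub (cutF i (ltnW im)) (cutF i.+1 im) (gap i im).
have cF i : i <= m -> #|(FB i).2| = i * N by move=> /cutF[].
exists (fun i => (FB i).2), (fun i => (FB i).1); split=> //.
- move=> i j /andP[]; elim: j => [|j IH]; first by rewrite leqn0 => /eqP->.
  rewrite leq_eqVlt => /predU1P[->//|ij jm].
  by apply: subset_trans (IH ij (ltnW jm)) (subS j jm).
- by move=> i x y /cutF c; apply: cut_downset c.
- move=> i x /cutF[_ _ ltF leF _]; split=> [/leF//|].
  by rewrite leqNgt; apply: contra => /ltF.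
move=> i im; have im' := ltnW im; have im'' := ltnW im'.
apply: upset_matching.
  rewrite !cardsD (setIidPr (subS _ im')) (setIidPr (subS _ im)) !cF //.
  by rewrite -!mulnBl !subSnn.
move=> I upI; have c1 := cutF i.+1 im'; have c2 := cutF i.+2 im.
rewrite mulSnr in c1; rewrite 2!mulSnr in c2.
exact: cut_hall k0 (slack_ge0 R V) lew w0 kwN slk (cutF i im'') c1 c2 upI.
Qed.

End Slabs.

(** * Order isomorphism between the Boolean cube and subsets of ['I_n] *)

Section Support.
Variable n : nat.
Implicit Types x y : cube n.

Definition supp x : {set 'I_n} := [set k | tnth x k].
Definition unsupp (A : {set 'I_n}) : cube n := [tuple k \in A | k < n].

Lemma suppK : cancel supp unsupp.
Proof. by move=> x; apply: eq_from_tnth => k; rewrite tnth_mktuple inE. Qed.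

Lemma unsuppK : cancel unsupp supp.
Proof. by move=> A; apply/setP=> k; rewrite inE tnth_mktuple. Qed.

Lemma le_supp x y : (x <= y)%O = (supp x \subset supp y).
Proof.
rewrite leEtprod; apply/forallP/subsetP=> [le k|sub k].
  by rewrite !inE => xk; have := le k; rewrite xk leEbool; case: (tnth y k).
by have := sub k; rewrite !inE leEbool; case: (tnth x k) => // ->.
Qed.

Lemma card_supp_preim (A : {set {set 'I_n}}) : #|supp @^-1: A| = #|A|.
Proof.
by apply: on_card_preimset; exists unsupp => x _; [apply: suppK|apply: unsuppK].
Qed.

End Support.

(** The value [10] enters as an equation so that [16 ^ t] and the factorial are never computed in
    unary. Both power conditions split [n ^ 10], as [n ^ 2 * n ^ 8] and as [n * n ^ 9]. *)
Lemma large_for_mul t n : t = 10 -> 16 <= n -> t ^ 2 <= n -> 16 ^ t <= n ->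
  16 * (2 * t)`! <= n -> large_for t n.
Proof.
move=> tE n16 nt n16t nf; have n0 : 0 < n by apply: leq_trans n16.
split=> //.
  have -> : n ^ t = n ^ 2 * n ^ 8 by rewrite tE -expnD.
  by rewrite leq_mul2r (leq_trans n16t) ?orbT // -{1}(expn1 n) leq_pexp2l.
have -> : n ^ t = n * n ^ 9 by rewrite tE -expnS.
by rewrite mulnAC leq_mul2r nf orbT.
Qed.

(** * From slabs to the sets [P] and the colouring *)

Section SlabColouring.
Variables (m n : nat) (F : nat -> {set {set 'I_n}}).
Let N := 2 ^ n %/ m.
Hypothesis m_gt0 : 0 < m.
Hypothesis cardF : forall i, i <= m -> #|F i| = i * N.
Hypothesis subF : forall i j, i <= j <= m -> F i \subset F j.
Hypothesis downF : forall i (x y : {set 'I_n}),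
  i <= m -> x \subset y -> y \in F i -> x \in F i.
Hypothesis matchF : forall i, i.+1 < m -> exists f : {set 'I_n} -> {set 'I_n},
  [/\ {in F i.+1 :\: F i &, injective f},
      f @: (F i.+1 :\: F i) = F i.+2 :\: F i.+1
    & {in F i.+1 :\: F i, forall x : {set 'I_n}, x \subset f x}].
Implicit Types (x y : cube n) (i j : nat).

Definition slab (i : nat) : {set cube n} := supp (n := n) @^-1: (F i.+1 :\: F i).

Lemma in_slab i x : (x \in slab i) = (supp x \notin F i) && (supp x \in F i.+1).
Proof. by rewrite !inE. Qed.

Lemma card_slab i : i < m -> #|slab i| = N.
Proof.
move=> im; have sub : F i \subset F i.+1 by apply: subF; rewrite leqnSn.
rewrite card_supp_preim cardsD (setIidPr sub) !cardF ?(ltnW im) //.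
by rewrite -mulnBl subSnn mul1n.
Qed.

Lemma slab_uniq i j x : i < m -> j < m -> x \in slab i -> x \in slab j -> i = j.
Proof.
wlog le : i j / i <= j.
  by move=> H im jm xi xj; case: (leqP i j) => [le|/ltnW le]; [|symmetry]; apply: H.
move: le; rewrite leq_eqVlt => /predU1P[//|ij] _ jm; rewrite !in_slab.
case/andP=> _ xi /andP[/negP[]].
by apply: subsetP xi; apply: subF; rewrite ij ltnW.
Qed.

Lemma in_bigcup_slab x : (x \in \bigcup_(i < m) slab i) = (supp x \in F m).
Proof.
apply/bigcupP/idP => [[i _]|xm].
  rewrite in_slab => /andP[_]; apply: subsetP.
  by apply: subF; rewrite leqnn andbT; apply: ltn_ord.
have F0 : F 0 = set0 by apply: cards0_eq; rewrite cardF ?mul0n.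
have ex : exists i, (i <= m) && (supp x \in F i) by exists m; rewrite leqnn.
case: (ex_minnP ex) => [[|i] /andP[im xi] mini]; first by rewrite F0 inE in xi.
exists (Ordinal im) => //; rewrite in_slab xi andbT; apply/negP=> xi'.
by have := mini i; rewrite xi' ltnW // ltnn => /(_ isT).
Qed.

Lemma cut_slab i x : i <= m -> supp x \in F i -> exists2 j : 'I_m, x \in slab j & j < i.
Proof.
move=> im xi; have : x \in \bigcup_(i < m) slab i.
  by rewrite in_bigcup_slab; apply: subsetP xi; apply: subF; rewrite im leqnn.
case/bigcupP=> j _ xj; exists j => //; rewrite ltnNge; apply/negP=> ij.
move: xj; rewrite in_slab => /andP[/negP[]]; apply: subsetP xi; apply: subF.
by rewrite ij ltnW.
Qed.

Lemma slab_matching i : i.+1 < m ->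
  exists sigma, monotone_bijection (slab i) (slab i.+1) sigma.
Proof.
move=> im; have [f [injf imf lef]] := matchF im.
exists (fun x => unsupp (f (supp x))); split=> [x y|| x].
- rewrite !inE => xi yi /(can_inj (@unsuppK n)) E; apply: (can_inj (@suppK n)).
  by apply: injf E; rewrite !inE.
- apply/setP=> y; rewrite [RHS]inE -imf; apply/imsetP/imsetP=> [[x]|[A Ai E]].
    by rewrite inE => xi ->; exists (supp x); rewrite ?unsuppK.
  exists (unsupp A); first by rewrite inE unsuppK.
  by rewrite unsuppK -E suppK.
by rewrite inE => xi; rewrite le_supp unsuppK lef.
Qed.

Lemma top_proof : m.-1 < m.
Proof. by rewrite prednK. Qed.

(** The default serves the vertices left over above the last cut; giving them the top colour keeps
    the map monotone. *)
Definition colour x : 'I_m := odflt (Ordinal top_proof) [pick i : 'I_m | x \in slab i].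

Lemma colour_slab (i : 'I_m) x : x \in slab i -> colour x = i.
Proof.
move=> xi; rewrite /colour; case: pickP => [j xj|/(_ i)]; last by rewrite xi.
by apply: val_inj; apply: slab_uniq xj xi; apply: ltn_ord.
Qed.

Lemma colour_top x : x \notin \bigcup_(i < m) slab i -> colour x = m.-1 :> nat.
Proof.
move=> nx; rewrite /colour; case: pickP => // i xi.
by case/negP: nx; apply/bigcupP; exists i.
Qed.

(** If [y] lies in slab [j], the down-set [F j.+1] contains [x] too, which places [x] in a slab of
    index at most [j]. *)
Lemma colour_homo : {homo colour : x y / (x <= y)%O >-> (x <= y)%N}.
Proof.
move=> x y xy; have [yF|/colour_top->] := boolP (y \in \bigcup_(i < m) slab i); last first.
  by rewrite -ltnS prednK.
case/bigcupP: yF => j _ yj; rewrite (colour_slab yj); move: yj; rewrite in_slab.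
case/andP=> _; rewrite le_supp in xy; move/(downF (ltn_ord j) xy).
by case/(cut_slab (ltn_ord j)) => i xi ij; rewrite (colour_slab xi).
Qed.

Lemma slab_level i : i < m -> slab i \subset level colour i.
Proof.
move=> im; apply/subsetP=> x xi; rewrite inE.
by rewrite (colour_slab (i := Ordinal im) xi).
Qed.

Lemma level_slab i x : x \in level colour i ->
  x \in slab i \/ i = m.-1 /\ supp x \notin F m.
Proof.
rewrite inE => /eqP xi.
have [|nx] := boolP (x \in \bigcup_(i < m) slab i).
  by case/bigcupP=> j _ xj; left; rewrite -xi (colour_slab xj).
by right; rewrite -in_bigcup_slab -xi colour_top.
Qed.

Lemma card_leftover : #|~: F m| <= m.
Proof.
have := cardsC (F m); rewrite cardF // -cardsT cardsT card_cube card_ord.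
have := ltn_ceil (2 ^ n) m_gt0; rewrite -/N mulSn; move: (2 ^ n) => e.
by rewrite [N * m]mulnC; lia.
Qed.

(** The slab bijections cover every slab, so only the leftover vertices, all of top colour and at
    most [m] in number, can be uncovered. *)
Lemma colour_matching (R : realType) :
  almost_perfect_matching colour (m%:R / 2 ^+ n : R)%R.
Proof.
have im (i : 'I_m.-1) : i.+1 < m by have := ltn_ord i; lia.
have /choice[sigma sigmaP] (i : 'I_m.-1) :
  exists s, monotone_bijection (slab i) (slab i.+1) s by apply: slab_matching.
exists (fun i : 'I_m.-1 => [set (x, sigma i x) | x in slab i]) => i.
have [injs ims les] := sigmaP i; split.
  split=> [x y /imsetP[u ui [-> ->]]|].
    have si : sigma i u \in slab i.+1 by rewrite -ims; apply: imset_f.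
    split; rewrite ?(subsetP (slab_level _)) // ?(ltnW (im i)) //.
    (* Strictness comes from the disjointness of consecutive slabs. *)
    rewrite lt_neqAle les // andbT; apply/eqP=> E; rewrite -E in si.
    by have := slab_uniq (ltnW (im i)) (im i) ui si; lia.
  split=> _ _ /imsetP[u ui ->] /imsetP[v vi ->] /= E; first by rewrite E.
  by rewrite (injs _ _ ui vi E).
rewrite divfK ?expf_neq0 ?pnatr_eq0 // ler_nat /uncovered.
have -> : [set e.1 | e in [set (x, sigma i x) | x in slab i]] = slab i.
  apply/setP=> x; apply/imsetP/idP=> [[_ /imsetP[u ui ->] ->]//|xi].
  by exists (x, sigma i x) => //; apply: imset_f.
have -> : [set e.2 | e in [set (x, sigma i x) | x in slab i]] = slab i.+1.
  rewrite -ims; apply/setP=> x; apply/imsetP/imsetP=> [[_ /imsetP[u ui ->] ->]|[u ui ->]].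
    by exists u.
  by exists (u, sigma i u) => //; apply: imset_f.
have -> : level colour i :\: slab i = set0.
  apply/setP=> x; rewrite in_setD in_set0; apply/negP=> /andP[nx /level_slab[xi|[E _]]].
    by rewrite xi in nx.
  by have := im i; lia.
rewrite cards0 add0n (leq_trans _ card_leftover) // -card_supp_preim.
apply: subset_leq_card; apply/subsetP=> x; rewrite in_setD => /andP[nx /level_slab[xi|[_]]].
  by rewrite xi in nx.
by rewrite !inE.
Qed.

End SlabColouring.

Theorem theorem3p13 (R : realType) :
  exists C : R, (0 < C)%R /\
  forall m n : nat, 0 < m -> (C * m%:R ^+ 6 <= n%:R)%R ->
  exists P : 'I_m -> {set cube n},
    (forall i j : 'I_m, i != j -> P i :&: P j = set0) /\
    (forall i : 'I_m, #|P i| = 2 ^ n %/ m) /\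
    (forall i j : 'I_m, j = i.+1 :> nat ->
       forall x y : cube n, x \in P i -> y \in P j -> hweight x <= hweight y) /\
    (forall x y : cube n, x \in \bigcup_(i < m) P i ->
       y \notin \bigcup_(i < m) P i -> hweight x <= hweight y) /\
    (forall i j : 'I_m, j = i.+1 :> nat ->
       exists sigma : cube n -> cube n, monotone_bijection (P i) (P j) sigma) /\
    exists phi : cube n -> 'I_m,
      (forall (i : 'I_m) (x : cube n), x \in P i -> phi x = i) /\
      (forall x : cube n, x \notin \bigcup_(i < m) P i ->
         phi x = m.-1 :> nat) /\
      {homo phi : x y / (x <= y)%O >-> (x <= y)%N} /\
      almost_perfect_matching phi (m%:R / 2 ^+ n : R)%R.
Proof.
(* The numerals are hidden behind equations to prevent unary computation; [A], [B] and [D] come from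
   the tail estimate, the neighbourhood size and the slab width. *)
have [t tE] : exists t, t = 10 by exists 10.
have t0 : 0 < t by rewrite tE.
have [A AE] : exists A, A = 16 ^ t by eexists.
have [B BE] : exists B, B = 16 * (2 * t)`! by eexists.
have [D DE] : exists D, D = (8 * (2 * t)) ^ 2 by eexists.
have A0 : 0 < A by rewrite AE expn_gt0.
have B0 : 0 < B by rewrite BE muln_gt0 fact_gt0.
have D0 : 0 < D by rewrite DE expn_gt0 !muln_gt0 t0.
exists (A * B * D)%:R%R; split; first by rewrite ltr0n !muln_gt0 A0 B0 D0.
move=> m n m0; rewrite -natrX -natrM ler_nat => cmn.
have [M ME] : exists M, M = m ^ 6 by eexists.
rewrite -ME in cmn; have M0 : 0 < M by rewrite ME expn_gt0 m0.
have An : A <= n by apply: leq_trans cmn; rewrite -!mulnA leq_pmulr // !muln_gt0 B0 D0 M0.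
have Bn : B <= n.
  by apply: leq_trans cmn; rewrite [A * B]mulnC -!mulnA leq_pmulr // !muln_gt0 A0 D0 M0.
have Dn : D * M <= n.
  by apply: leq_trans cmn; rewrite -[A * B * D * _]mulnA leq_pmull // muln_gt0 A0 B0.
have DN : D <= n by apply: leq_trans Dn; rewrite leq_pmulr.
have n_large : large_for t n.
  apply: large_for_mul => //; rewrite -?AE -?BE //.
    by apply: leq_trans Bn; rewrite BE leq_pmulr // fact_gt0.
  by apply: leq_trans DN; rewrite DE leq_sqr; lia.
have kmn : (8 * (2 * t) * m) ^ 2 <= n.
  by apply: leq_trans Dn; rewrite expnMn -DE ME leq_mul2l leq_pexp2l ?orbT.
(* The set-family results are instantiated at [V = 'I_n]. *)
rewrite -[n]card_ord in n_large kmn.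
have [F [b [cardF subF downF weightF matchF]]] := @slabs_exist R _ t m t0 m0 n_large kmn.
rewrite card_ord in cardF.
exists (fun i : 'I_m => slab F i); split; [|split; [|split; [|split; [|split]]]].
- move=> i j ij; apply/setP=> x; rewrite inE in_set0; apply/negP=> /andP[xi xj].
  by case/eqP: ij; apply: val_inj; apply: (slab_uniq subF) xi xj; apply: ltn_ord.
- by move=> i; apply: card_slab.
- move=> i j ji x y; rewrite !in_slab ji => /andP[_ xi] /andP[yi _].
  have [le _] := weightF i.+1 (supp x) (ltn_ord i).
  have [_ ge] := weightF i.+1 (supp y) (ltn_ord i).
  exact: leq_trans (le xi) (ge yi).
- move=> x y; rewrite !(in_bigcup_slab cardF subF) => xm ym.
  have [le _] := weightF m (supp x) (leqnn m).
  have [_ ge] := weightF m (supp y) (leqnn m).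
  exact: leq_trans (le xm) (ge ym).
- by move=> i j ji; rewrite ji; apply: (slab_matching matchF); rewrite -ji.
exists (colour F m0); split; [|split; [|split]].
- exact: colour_slab.
- exact: colour_top.
- exact: colour_homo.
- exact: colour_matching.
Qed.
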